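(* Let $\mathbf A\in\mathbb R^{n\times d}$ and $\mathbf b\in\mathbb R^n$, and let $\tau_1,\dots,\tau_n$ be the leverage scores of $\mathbf A$. Fix $D\ge 1$. There is a constant $C>0$ depending only on $D$ such that the following holds for every $\epsilon\in(0,1)$. Let $\boldsymbol\xi=(\xi_1,\dots,\xi_n)\in\{0,1\}^n$ be a random vector whose distribution $\mu$ (i) is $k$-homogeneous, (ii) is one-sided $\ell_\infty$-independent with parameter $D$, and (iii) has marginals $\Pr[\xi_i=1]=\tilde p_i:=\min(1,c\,\tau_i)$ for all $i$, for some constant $c>0$. Let $\tilde{\mathbf A}$, $\tilde{\mathbf b}$ be the reweighted subsampled data and target determined by $\boldsymbol\xi$, and let $\tilde{\mathbf x}^*\in\arg\min_{\mathbf x\in\mathbb R^d}\|\tilde{\mathbf A}\mathbf x-\tilde{\mathbf b}\|_2^2$. If $k\ge C\,(d\log d+d/\epsilon)$, then with probability at least $99/100$, $$\|\mathbf A\tilde{\mathbf x}^*-\mathbf b\|_2^2\le(1+\epsilon)\min_{\mathbf x\in\mathbb R^d}\|\mathbf A\mathbf x-\mathbf b\|_2^2 .$$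
   Context: Leverage scores: let $\mathbf U$ be a matrix whose columns form an orthonormal basis of the column span of $\mathbf A$, with rows $\mathbf u_i$; the $i$-th leverage score is $\tau_i=\|\mathbf u_i\|_2^2=\mathbf a_i^T(\mathbf A^T\mathbf A)^{+}\mathbf a_i$, where $\mathbf a_i$ is the $i$-th row of $\mathbf A$; $\sum_i\tau_i=\mathrm{rank}(\mathbf A)\le d$. Homogeneity: a distribution on $\{0,1\}^n$ is $k$-homogeneous if every realization has exactly $k$ ones. One-sided $\ell_\infty$-independence: for $\mathcal S\subseteq[n]$ and $i,j\in[n]\setminus\mathcal S$ (with the conditioning events of positive probability) set $\mathcal I^{\mathcal S}_\mu(i,j)=\Pr[\xi_j=1\mid \xi_i=1,\ \xi_\ell=1\ \forall\ell\in\mathcal S]-\Pr[\xi_j=1\mid \xi_\ell=1\ \forall\ell\in\mathcal S]$; $\mu$ is one-sided $\ell_\infty$-independent with parameter $D$ if $\max_i\sum_j|\mathcal I^{\mathcal S}_\mu(i,j)|\le D$ for all $\mathcal S\subseteq[n]$. Reweighted subsample: $\tilde{\mathbf A}$ has one row $\mathbf a_i/\sqrt{\tilde p_i}$ for each $i$ with $\xi_i=1$, and $\tilde{\mathbf b}$ has the corresponding entries $b_i/\sqrt{\tilde p_i}$ (equivalently $\tilde{\mathbf A}=\mathbf S\mathbf A$, $\tilde{\mathbf b}=\mathbf S\mathbf b$ where $\mathbf S\in\mathbb R^{k\times n}$ has one row per selected $i$, equal to $1/\sqrt{\tilde p_i}$ in column $i$ and $0$ elsewhere). *)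

(* Defs.v *)
From HB Require Import structures.
From mathcomp Require Import all_boot all_order all_algebra.
From mathcomp Require Import boolp reals exp.
Set Implicit Arguments. Unset Strict Implicit. Unset Printing Implicit Defensive.
Import Order.TTheory GRing.Theory Num.Theory.
Local Open Scope ring_scope.

Section Defs.
Variable R : realType.

Definition sqnorm (m : nat) (v : 'cV[R]_m) : R := \sum_(i < m) (v i 0) ^+ 2.

(* U has orthonormal columns forming a basis of the column span of A
   (column span of A = row space of A^T). *)
Definition orthonormal_basis_of_colspan (n d r : nat)
    (A : 'M[R]_(n, d)) (U : 'M[R]_(n, r)) : Prop :=
  U^T *m U = 1%:M /\ (U^T == A^T)%MS.

Definition leverage (n r : nat) (U : 'M[R]_(n, r)) (i : 'I_n) : R :=
  \sum_(j < r) (U i j) ^+ 2.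

Notation outcome n := {ffun 'I_n -> bool}.

Definition is_distr (n : nat) (mu : outcome n -> R) : Prop :=
  (forall w, 0 <= mu w) /\ \sum_(w : outcome n) mu w = 1.

Definition Pr (n : nat) (mu : outcome n -> R) (E : outcome n -> Prop) : R :=
  \sum_(w : outcome n | `[< E w >]) mu w.

Definition condPr (n : nat) (mu : outcome n -> R) (E F : outcome n -> Prop) : R :=
  Pr mu (fun w => E w /\ F w) / Pr mu F.

Definition homogeneous (n : nat) (mu : outcome n -> R) (k : nat) : Prop :=
  forall w, 0 < mu w -> #|[set i | w i]| = k.

Definition allOnes (n : nat) (S : {set 'I_n}) (w : outcome n) : Prop :=
  forall l, l \in S -> w l.

Definition influence (n : nat) (mu : outcome n -> R) (S : {set 'I_n}) (i j : 'I_n) : R :=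
  condPr mu (fun w => w j) (fun w => w i /\ allOnes S w)
  - condPr mu (fun w => w j) (allOnes S).

Definition one_sided_linf_indep (n : nat) (mu : outcome n -> R) (D : R) : Prop :=
  forall (S : {set 'I_n}) (i : 'I_n), i \notin S ->
    0 < Pr mu (fun w => w i /\ allOnes S w) ->
    \sum_(j in ~: S) `|influence mu S i j| <= D.

Definition ptilde (n r : nat) (U : 'M[R]_(n, r)) (c : R) (i : 'I_n) : R :=
  Num.min 1 (c * leverage U i).

Definition sketch (n : nat) (p : 'I_n -> R) (w : outcome n)
    : 'M[R]_(#|[set i | w i]|, n) :=
  \matrix_(s, j) (if j == enum_val s then (Num.sqrt (p j))^-1 else 0).

End Defs.
Notation outcome n := {ffun 'I_n -> bool}.

(* Main.v *)
Require Import Defs.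
From HB Require Import structures.
From mathcomp Require Import all_boot all_order all_algebra.
From mathcomp Require Import ring lra.
From mathcomp Require Import boolp reals exp.
Import Order.TTheory GRing.Theory Num.Theory.
Local Open Scope ring_scope.

(** Write [u_j] for the rows of [U], [p_j] for the marginals, and let [S] run through
    the sets of indices already revealed to be selected. The matrix
    [H_S = 1 + sum_j h_j u_j^T u_j], with
    [h_j = (3/4 Pr(xi_j = 1 | S) + 1/4 [j in S, p_j < 1]) / p_j],
    starts at [7/4] for [S] empty and ends below [1 + M], where [M] is the sketched
    Gram matrix. Revealing one more selected index leaves the first part of [h] a
    martingale, while the second part can only grow; one-sided independence and
    homogeneity bound the second moment of the increment by this growth, so the
    potential [tr (H_S ^ -q)] does not increase on average once [c] is large compared
    with [q D^2]. If [M] had an eigenvalue below [1/2], the final potential would be at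
    least [(2/3)^q], whereas it starts at [r (4/7)^q]; hence [M >= 1/2] except with
    probability [r (6/7)^q], and [q] of order [1 + ln d] suffices. On the event
    [M >= 1/2] the excess risk is at most 16 times the squared norm of
    [sum_j xi_j v_j u_j / p_j], [v] being the optimal residual; its expectation is at
    most [D / c |v|^2], and Markov's inequality concludes. *)

Set Implicit Arguments.
Unset Strict Implicit.
Unset Printing Implicit Defensive.

(** * Trace inequalities for products of matrices and their dyadic powers *)

Section TraceInequalities.
Variable R : realType.

Lemma mxtrace_mul_tr (m n : nat) (C : 'M[R]_(m, n)) :
  \tr (C *m C^T) = \sum_i \sum_j C i j ^+ 2.
Proof.
apply: eq_bigr => i _; rewrite mxE; apply: eq_bigr => j _.
by rewrite mxE expr2.
Qed.

Lemma mxtrace_mul_tr_ge0 (m n : nat) (C : 'M[R]_(m, n)) : 0 <= \tr (C *m C^T).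
Proof.
by rewrite mxtrace_mul_tr; do 2![apply: sumr_ge0 => ? _]; apply: sqr_ge0.
Qed.

Lemma expmxS (n : nat) (A : 'M[R]_n) (k : nat) : A ^+ k.+1 = A *m A ^+ k.
Proof. exact: exprS. Qed.

Lemma expmxSr (n : nat) (A : 'M[R]_n) (k : nat) : A ^+ k.+1 = A ^+ k *m A.
Proof. exact: exprSr. Qed.

Lemma expmx2 (n : nat) (A : 'M[R]_n) : A ^+ 2 = A *m A.
Proof. exact: expr2. Qed.

Lemma trmx_exp (n : nat) (A : 'M[R]_n) (k : nat) : (A ^+ k)^T = A^T ^+ k.
Proof.
elim: k => [|k IH]; first by rewrite !expr0 trmx1.
by rewrite expmxS expmxSr trmx_mul IH.
Qed.

Lemma mulmx_exp_shift (m n : nat) (A : 'M[R]_(m, n)) (B : 'M[R]_(n, m)) (k : nat) :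
  (A *m B) ^+ k *m A = A *m (B *m A) ^+ k.
Proof.
elim: k => [|k IH]; first by rewrite !expr0 mul1mx mulmx1.
by rewrite !expmxS -mulmxA IH !mulmxA.
Qed.

Lemma mxtrace_exp_mulC (m n : nat) (A : 'M[R]_(m, n)) (B : 'M[R]_(n, m)) (k : nat) :
  \tr ((A *m B) ^+ k.+1) = \tr ((B *m A) ^+ k.+1).
Proof.
by rewrite expmxSr mulmxA mulmx_exp_shift mxtrace_mulC mulmxA expmxS.
Qed.

(** Expansion of the nonnegative squared Frobenius norm of [A - B^T]. *)
Lemma mxtrace_mul_le_half (n : nat) (A B : 'M[R]_n) :
  \tr (A *m B) <= (\tr (A *m A^T) + \tr (B^T *m B)) / 2.
Proof.
have := mxtrace_mul_tr_ge0 (A - B^T).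
rewrite linearB /= trmxK mulmxBl !mulmxBr !linearB /=.
rewrite [\tr (B^T *m A^T)]mxtrace_mulC -trmx_mul mxtrace_tr.
rewrite [\tr (B *m A)]mxtrace_mulC.
set a := \tr _; set b := \tr _; set c := \tr _; lra.
Qed.

(* Each of the two inequalities at level [j.+1] needs the other one at level [j]; only
   exponents that are powers of two are obtained, which avoids spectral calculus. *)
Lemma mxtrace_exp_pow2 (n j : nat) :
  (forall C : 'M[R]_n, \tr (C ^+ (2 ^ j.+1)%N) <= \tr ((C *m C^T) ^+ (2 ^ j)%N)) /\
  (forall A B : 'M[R]_n, A^T = A -> B^T = B ->
     \tr ((A *m B) ^+ (2 ^ j)%N) <= \tr (A ^+ (2 ^ j)%N *m B ^+ (2 ^ j)%N)).
Proof.
have pos i : exists l, (2 ^ i = l.+1)%N.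
  by exists (2 ^ i).-1; rewrite prednK // expn_gt0.
elim: j => [|j [IHC IHAB]].
  split=> [C|A B _ _]; last by rewrite !expr1.
  rewrite expmx2 expr1; apply: le_trans (mxtrace_mul_le_half C C) _.
  by rewrite [\tr (C^T *m C)]mxtrace_mulC; lra.
split=> [C|A B hA hB].
  (* [IHC] for [C ^+ 2] yields a power of [C *m C *m C^T *m C^T]; a cyclic shift turns it into a
     product of the symmetric matrices [C^T *m C] and [C *m C^T], to which [IHAB] applies. *)
  rewrite expnS exprM; apply: le_trans (IHC _) _.
  rewrite trmx_exp !expmx2 !mulmxA.
  have [l el] := pos j.
  have -> : \tr ((C *m C *m C^T *m C^T) ^+ (2 ^ j)%N)
          = \tr ((C^T *m C *m (C *m C^T)) ^+ (2 ^ j)%N).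
    by rewrite el mxtrace_exp_mulC !mulmxA.
  apply: le_trans (IHAB _ _ _ _) _; rewrite ?trmx_mul ?trmxK //.
  apply: le_trans (mxtrace_mul_le_half _ _) _.
  rewrite !trmx_exp !trmx_mul !trmxK -!expmx2.
  rewrite -!exprM -expnSr.
  have [l' ->] := pos j.+1.
  by rewrite [\tr ((C^T *m C) ^+ _)]mxtrace_exp_mulC; lra.
apply: le_trans (IHC _) _.
rewrite trmx_mul hA hB.
have [l el] := pos j.
have -> : \tr ((A *m B *m (B *m A)) ^+ (2 ^ j)%N) = \tr ((A ^+ 2 *m B ^+ 2) ^+ (2 ^ j)%N).
  by rewrite el !mulmxA mxtrace_exp_mulC !expmx2 !mulmxA.
apply: le_trans (IHAB _ _ _ _) _; rewrite ?trmx_exp ?hA ?hB //.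
by rewrite -!exprM -expnS.
Qed.

Lemma mxtrace_Lieb_Thirring (n j : nat) (A B : 'M[R]_n) : A^T = A -> B^T = B ->
  \tr ((A *m B) ^+ (2 ^ j)%N) <= \tr (A ^+ (2 ^ j)%N *m B ^+ (2 ^ j)%N).
Proof. exact: (mxtrace_exp_pow2 n j).2. Qed.

End TraceInequalities.

(** * Quadratic forms and semidefiniteness *)

Section QuadraticForms.
Variable R : realType.

Definition qform (n : nat) (A : 'M[R]_n) (x : 'cV[R]_n) : R := (x^T *m A *m x) 0 0.

Definition psdmx (n : nat) (A : 'M[R]_n) : Prop := forall x, 0 <= qform A x.

Lemma sqnormE (n : nat) (x : 'cV[R]_n) : sqnorm x = (x^T *m x) 0 0.
Proof. by rewrite mxE; apply: eq_bigr => i _; rewrite mxE expr2. Qed.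

Lemma sqnorm_ge0 (n : nat) (x : 'cV[R]_n) : 0 <= sqnorm x.
Proof. by apply: sumr_ge0 => i _; apply: sqr_ge0. Qed.

Lemma sqnorm_eq0 (n : nat) (x : 'cV[R]_n) : sqnorm x = 0 -> x = 0.
Proof.
move=> h; apply/matrixP => i j; rewrite ord1 mxE.
have /eqP := h; rewrite psumr_eq0 => [/allP /(_ i)|k _]; last exact: sqr_ge0.
by rewrite mem_index_enum sqrf_eq0 => /(_ isT) /eqP.
Qed.

Lemma qform1 (n : nat) (x : 'cV[R]_n) : qform 1 x = sqnorm x.
Proof. by rewrite sqnormE /qform mulmx1. Qed.

Lemma qformD (n : nat) (A B : 'M[R]_n) x : qform (A + B) x = qform A x + qform B x.
Proof. by rewrite /qform mulmxDr mulmxDl mxE. Qed.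

Lemma qformZ (n : nat) a (A : 'M[R]_n) x : qform (a *: A) x = a * qform A x.
Proof. by rewrite /qform -scalemxAr -scalemxAl mxE. Qed.

Lemma qformN (n : nat) (A : 'M[R]_n) x : qform (- A) x = - qform A x.
Proof. by rewrite -scaleN1r qformZ mulN1r. Qed.

Lemma qformB (n : nat) (A B : 'M[R]_n) x : qform (A - B) x = qform A x - qform B x.
Proof. by rewrite qformD qformN. Qed.

Lemma qform_sum (n : nat) (I : finType) (P : pred I) (A : I -> 'M[R]_n) x :
  qform (\sum_(i | P i) A i) x = \sum_(i | P i) qform (A i) x.
Proof. by rewrite /qform mulmx_sumr mulmx_suml summxE. Qed.

Lemma qform_congr (m n : nat) (A : 'M[R]_m) (B : 'M[R]_(m, n)) x :
  qform (B^T *m A *m B) x = qform A (B *m x).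
Proof. by rewrite /qform trmx_mul !mulmxA. Qed.

Lemma qform_gram (m n : nat) (B : 'M[R]_(m, n)) x : qform (B^T *m B) x = sqnorm (B *m x).
Proof. by rewrite sqnormE /qform trmx_mul !mulmxA. Qed.

Lemma psdmxD (n : nat) (A B : 'M[R]_n) : psdmx A -> psdmx B -> psdmx (A + B).
Proof. by move=> hA hB x; rewrite qformD addr_ge0. Qed.

Lemma psdmx_congr (m n : nat) (A : 'M[R]_m) (B : 'M[R]_(m, n)) :
  psdmx A -> psdmx (B^T *m A *m B).
Proof. by move=> hA x; rewrite qform_congr. Qed.

Lemma sum_sqr_lincomb (I : finType) (f g : I -> R) (a b : R) :
  \sum_i (a * f i + b * g i) ^+ 2 =
  a ^+ 2 * (\sum_i f i ^+ 2) + 2 * a * b * (\sum_i f i * g i) + b ^+ 2 * (\sum_i g i ^+ 2).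
Proof. by rewrite !mulr_sumr -!big_split /=; apply: eq_bigr => i _; ring. Qed.

Lemma Cauchy_Schwarz (n : nat) (x y : 'cV[R]_n) :
  ((x^T *m y) 0 0) ^+ 2 <= sqnorm x * sqnorm y.
Proof.
have [y0|ny0] := eqVneq (sqnorm y) 0.
  by rewrite (sqnorm_eq0 y0) mulmx0 mxE expr0n mulr_ge0 ?sqnorm_ge0.
have yp : 0 < sqnorm y by rewrite lt_def ny0 sqnorm_ge0.
have -> : (x^T *m y) 0 0 = \sum_i x i 0 * y i 0.
  by rewrite mxE; apply: eq_bigr => i _; rewrite mxE.
set t := \sum_i _.
have : 0 <= \sum_i (sqnorm y * x i 0 + (- t) * y i 0) ^+ 2.
  by apply: sumr_ge0 => i _; apply: sqr_ge0.
rewrite sum_sqr_lincomb -/(sqnorm x) -/(sqnorm y) -/t => h.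
rewrite -subr_ge0 -(pmulr_rge0 _ yp); apply: le_trans h _.
by rewrite le_eqVlt; apply/orP; left; apply/eqP; ring.
Qed.

Lemma mxtrace_mul_gram (m n : nat) (A : 'M[R]_m) (L : 'M[R]_(m, n)) :
  \tr (A *m (L *m L^T)) = \sum_j qform A (col j L).
Proof.
rewrite mulmxA mxtrace_mulC; apply: eq_bigr => j _.
rewrite /qform -mulmxA !mxE; apply: eq_bigr => i _; rewrite !mxE.
by congr (_ * _); apply: eq_bigr => l _; rewrite !mxE.
Qed.

(** This is how semidefinite inequalities become trace inequalities below: they are traced against a
    matrix exhibited as a Gram matrix. *)
Lemma mxtrace_mul_gram_ge0 (m n : nat) (A : 'M[R]_m) (L : 'M[R]_(m, n)) :
  psdmx A -> 0 <= \tr (A *m (L *m L^T)).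
Proof. by move=> hA; rewrite mxtrace_mul_gram; apply: sumr_ge0. Qed.

Lemma coercive_unitmx (n : nat) (A : 'M[R]_n) (c : R) : 0 < c ->
  (forall x, c * sqnorm x <= qform A x) -> A \in unitmx.
Proof.
move=> c0 h; rewrite unitmxE unitfE; apply/negP => /det0P [v v0 vA].
have := h v^T; rewrite /qform trmxK vA mul0mx mxE pmulr_rle0 // => sv.
have /sqnorm_eq0 vT0 : sqnorm v^T = 0 by apply/le_anti; rewrite sv sqnorm_ge0.
by rewrite -[v]trmxK vT0 trmx0 eqxx in v0.
Qed.

End QuadraticForms.

(** * Bernoulli's inequality for even inverse powers of [1 + Y] *)

Section BernoulliInverse.
Variables (R : realType) (n : nat) (Y : 'M[R]_n.+1).
Hypothesis symY : Y^T = Y.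

(** Inequalities between functions of [Y] are proved for polynomials, where everything commutes:
    those semidefinite at [Y] form a cone stable under multiplication by squares. *)
Let psd_at (p : {poly R}) : Prop := psdmx (horner_mx Y p).

Lemma trmx_horner_mx (p : {poly R}) : (horner_mx Y p)^T = horner_mx Y p.
Proof.
elim/poly_ind: p => [|p c IH]; first by rewrite rmorph0 trmx0.
rewrite rmorphD rmorphM /= horner_mx_X horner_mx_C linearD /= tr_scalar_mx.
congr (_ + _); rewrite -[_ * _]/(_ *m _) trmx_mul IH symY.
by rewrite -[LHS]/(Y * _) -[RHS]/(_ * Y) -{1 4}(horner_mx_X Y) -!rmorphM mulrC.
Qed.

Let psd_atD p q : psd_at p -> psd_at q -> psd_at (p + q).
Proof. by rewrite /psd_at rmorphD; apply: psdmxD. Qed.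

Let psd_at_sqr p q : psd_at p -> psd_at (q ^+ 2 * p).
Proof.
move=> hp; rewrite /psd_at expr2 -mulrA [q * p]mulrC mulrA !rmorphM /=.
by rewrite -{1}(trmx_horner_mx q); apply: psdmx_congr.
Qed.

Let psd_atMn p k : psd_at p -> psd_at (p *+ k).
Proof.
move=> hp; elim: k => [|k IH]; last by rewrite mulrS; apply: psd_atD.
by rewrite mulr0n /psd_at rmorph0 => x; rewrite /qform mulmx0 mul0mx mxE.
Qed.

Let psd_at1 : psd_at 1.
Proof. by rewrite /psd_at rmorph1 => x; rewrite qform1 sqnorm_ge0. Qed.

Variables (l : nat).
Hypothesis l_gt0 : (0 < l)%N.
(** With an even exponent, [Z ^+ q] arises from a congruence by [Z ^+ l]. *)
Let q : nat := l.*2.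
Hypothesis Y_ge : psdmx (1 + (2 * q%:R) *: Y).

Let Q : {poly R} := q%:R.

Let psd_at_lin : psd_at (1 + 2 * Q * 'X).
Proof.
rewrite /psd_at rmorphD rmorph1 rmorphM /= horner_mx_X.
suff -> : horner_mx Y (2 * Q) * Y = (2 * q%:R) *: Y by [].
have -> : 2 * Q = (2 * q%:R)%:P by rewrite polyCM /Q !polyC_natr.
by rewrite horner_mx_C; apply: mul_scalar_mx.
Qed.

Let psd_at_1X : psd_at (1 + 'X).
Proof.
rewrite /psd_at rmorphD rmorph1 /= horner_mx_X => x.
have := Y_ge x; rewrite !qformD qformZ qform1; have := sqnorm_ge0 x.
have q1 : 1 <= q%:R :> R by rewrite ler1n /q double_gt0.
nra.
Qed.

Let psd_at_pow p j : psd_at p -> psd_at (p ^+ j).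
Proof.
move=> hp; rewrite -(odd_double_half j) exprD -mul2n mulnC exprM mulrC.
by apply: psd_at_sqr; case: (odd j); rewrite ?expr0 ?expr1.
Qed.

(* Bernoulli's inequality with a remainder [G] that is a sum of powers of [1 + 'X], so
   that it is positive semidefinite at [Y] although no eigenvalue of [Y] is at hand. *)
Let Bernoulli_poly m : exists2 G : {poly R},
  (forall j, psd_at (G * (1 + 'X) ^+ j)) & (1 + 'X) ^+ m = 1 + m%:R * 'X + 'X ^+ 2 * G.
Proof.
elim: m => [|m [G hG e]].
  by exists 0 => [j|]; [rewrite mul0r; apply: (psd_atMn 0 psd_at1) | rewrite expr0; ring].
exists (m%:R + G * (1 + 'X)) => [j|]; last by rewrite exprSr e -[m.+1%:R]natr1; ring.
rewrite mulrDl -mulrA -exprS; apply: psd_atD => //.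
by rewrite mulr_natl; apply/psd_atMn/psd_at_pow.
Qed.

(** For [F = 1 - Q X + 2 Q^2 X^2], the polynomial [F (1 + X)^q - 1] lies in the cone, and congruence
    by [Z ^+ l] turns it into the claim. The coefficient [2 q^2] exceeds the Taylor coefficient
    [q (q + 1) / 2], leaving room for the higher-order terms. *)
Lemma Bernoulli_inverse (Z : 'M[R]_n.+1) : Z *m (1 + Y) = 1 ->
  psdmx (1 - q%:R *: Y + (2 * q%:R ^+ 2) *: Y ^+ 2 - Z ^+ q).
Proof.
move=> ZW.
have [G hG eG] := Bernoulli_poly q.
pose F : {poly R} := 1 - Q * 'X + 2 * Q ^+ 2 * 'X ^+ 2.
have hp : psd_at (F * (1 + 'X) ^+ q - 1).
  pose H : {poly R} := l%:R.
  have QH : Q = 2 * H by rewrite /Q /H /q -muln2 natrM mulrC.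
  (* The first summand is [F (1 + Q X) - 1]; the others are [F = (1 - H X)^2 + 7 (H X)^2] times the
     Bernoulli remainder [X^2 G]. *)
  have -> : F * (1 + 'X) ^+ q - 1 = (Q * 'X) ^+ 2 * (1 + 2 * Q * 'X)
     + (((1 - H * 'X) * 'X) ^+ 2 * G + ((H * 'X * 'X) ^+ 2 * G) *+ 7).
    by rewrite eG -/Q /F QH; ring.
  have G0 : psd_at G by have := hG 0%N; rewrite expr0 mulr1.
  by apply: psd_atD; [|apply: psd_atD; [|apply: psd_atMn]]; apply: psd_at_sqr.
have WZ : (1 + Y) *m Z = 1 by apply: mulmx1C.
have symZ : Z^T = Z.
  have : Z^T *m (1 + Y) = 1.
    have tr1 : (1 : 'M[R]_n.+1)^T = 1 by apply: trmx1.
    by have := congr1 trmx WZ; rewrite trmx_mul linearD /= symY tr1.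
  by move/(congr1 (mulmx^~ Z)); rewrite /= -mulmxA WZ mulmx1 mul1mx.
have cZY : GRing.comm Z Y.
  have -> : Y = (1 + Y) - 1 by rewrite addrC addKr.
  apply: commrB; last exact: commr1.
  by rewrite /GRing.comm -![_ * _]/(_ *m _) ZW WZ.
have cZp p : GRing.comm Z (horner_mx Y p).
  elim/poly_ind: p => [|p c IH]; first by rewrite rmorph0; apply: commr0.
  rewrite rmorphD rmorphM /= horner_mx_X horner_mx_C; apply: commrD.
    exact: commrM.
  by rewrite /GRing.comm -![_ * _]/(_ *m _) scalar_mxC.
have hF : horner_mx Y F = 1 - q%:R *: Y + (2 * q%:R ^+ 2) *: Y ^+ 2.
  have -> : F = 1 - q%:R%:P * 'X + (2 * q%:R ^+ 2)%:P * 'X ^+ 2.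
    by rewrite polyCM expr2 polyCM -expr2 !polyC_natr.
  rewrite rmorphD rmorphB rmorph1 [X in _ - X]rmorphM [X in _ + X]rmorphM.
  rewrite [X in _ + _ * X]rmorphXn /= horner_mx_X !horner_mx_C.
  by congr (_ - _ + _); apply: mul_scalar_mx.
have hW : horner_mx Y (1 + 'X) = 1 + Y by rewrite rmorphD rmorph1 /= horner_mx_X.
have cZW : GRing.comm Z (1 + Y) by rewrite -hW.
have Zl : Z ^+ l * (1 + Y) ^+ l = 1.
  by rewrite -exprMn_comm // -[Z * _]/(Z *m _) ZW expr1n.
have -> : 1 - q%:R *: Y + (2 * q%:R ^+ 2) *: Y ^+ 2 - Z ^+ q
   = (Z ^+ l)^T *m horner_mx Y (F * (1 + 'X) ^+ q - 1) *m Z ^+ l.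
  rewrite trmx_exp symZ rmorphB rmorph1 rmorphM rmorphXn /= hW hF.
  set E := 1 - _ + _.
  have cE : GRing.comm (Z ^+ l) E by rewrite /E -hF; apply/commr_sym/commrX/commr_sym.
  have Wl : (1 + Y) ^+ l * Z ^+ l = 1.
    by rewrite -exprMn_comm; [rewrite -[_ * Z]/(_ *m Z) WZ expr1n | apply/commr_sym].
  transitivity (Z ^+ l * (E * (1 + Y) ^+ q - 1) * Z ^+ l) => //.
  rewrite mulrBr mulrBl mulr1 /q -addnn !exprD.
  by rewrite !mulrA cE -(mulrA E) Zl mulr1 -mulrA Wl mulr1.
exact: psdmx_congr.
Qed.

End BernoulliInverse.

(** * The inverse of a Gram matrix that dominates the identity *)

Section InverseOfGram.
Variables (R : realType) (r N : nat) (V : 'M[R]_(N.+1, r)).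
Let H : 'M[R]_r := V^T *m V.
Hypothesis H_ge1 : forall x, sqnorm x <= qform H x.
Let P := invmx H.

Lemma gram_unitmx : H \in unitmx.
Proof. by apply: (coercive_unitmx (c := 1)) => // x; rewrite mul1r. Qed.

Let symH : H^T = H.
Proof. by rewrite /H trmx_mul trmxK. Qed.

Let symP : P^T = P.
Proof. by rewrite /P trmx_inv symH. Qed.

(** With [y = P *m x], Cauchy-Schwarz bounds the square of [qform P x] by [sqnorm x * sqnorm y], and
    [sqnorm y <= qform H y = qform P x]. *)
Lemma qform_inv_le x : qform P x <= sqnorm x.
Proof.
have Px : qform P x = qform H (P *m x).
  by rewrite -qform_congr symP mulVmx ?gram_unitmx // mul1mx.
have := Cauchy_Schwarz x (P *m x); rewrite mulmxA -/(qform P x).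
have := H_ge1 (P *m x); rewrite -Px.
have := sqnorm_ge0 x; have := sqnorm_ge0 (P *m x); nra.
Qed.

End InverseOfGram.

(** * Traces of powers of an inverse under perturbation *)

Section ResolventPowers.
Variables (R : realType) (r N : nat) (V : 'M[R]_(N.+1, r)).
(** [P] stands for the inverse of [V^T *m V], and [L] for [P *m V^T], a rectangular substitute for a
    square root of [P]. *)
Variables (P : 'M[R]_r) (L : 'M[R]_(r, N.+1)).
Hypotheses (symP : P^T = P) (P_le1 : forall x, qform P x <= sqnorm x).
Hypotheses (LLT : L *m L^T = P) (VTLT : V^T *m L^T = 1) (VTVL : V^T *m V *m L = V^T).
Let H : 'M[R]_r := V^T *m V.

(** With [s] the left side, Cauchy-Schwarz between [x] and [L^T *m L *m x] gives
    [s ^+ 2 <= sqnorm x * s], because [P] is below the identity. *)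
Let L_contract x : sqnorm (L *m x) <= sqnorm x.
Proof.
have := Cauchy_Schwarz x (L^T *m (L *m x)).
rewrite -[sqnorm (L^T *m _)]qform_gram trmxK LLT.
have -> : (x^T *m (L^T *m (L *m x))) 0 0 = sqnorm (L *m x).
  by rewrite sqnormE trmx_mul !mulmxA.
have := P_le1 (L *m x).
have := sqnorm_ge0 x; case: (lerP (sqnorm (L *m x)) (sqnorm x)) => //; nra.
Qed.

Lemma exp_inv_gram l : P ^+ (l.*2).+1 = (P ^+ l *m L) *m (P ^+ l *m L)^T.
Proof.
rewrite (trmx_mul (P ^+ l) L) trmx_exp symP !mulmxA -(mulmxA _ L) LLT.
by rewrite -expmxSr -[_ *m _]/(_ * _) -exprD addSn addnn.
Qed.

Variable m : nat.
Let q : nat := (2 ^ m.+1)%N.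

(* The factorization [invmx (H + D) = L *m invmx (1 + L^T *m D *m L) *m L^T] is
   what brings the trace into the shape of the Lieb-Thirring inequality without
   a square root of [H]. *)
Lemma mxtrace_inv_perturb (D : 'M[R]_r) : D^T = D ->
  psdmx (1 + (2 * q%:R) *: D) ->
  \tr (invmx (H + D) ^+ q) <=
    \tr (P ^+ q) - q%:R * \tr (D *m P ^+ q.+1)
    + 2 * q%:R ^+ 2 * \tr (D *m D *m P ^+ q.+1).
Proof.
move=> symD D_ge.
pose Y := L^T *m D *m L; pose B := L^T *m L; pose Z := invmx (1 + Y).
have symY : Y^T = Y by rewrite /Y (trmx_mul _ L) (trmx_mul _ D) trmxK symD mulmxA.
have symB : B^T = B by rewrite /B (trmx_mul _ L) trmxK.
have q1 : 1 <= q%:R :> R by rewrite ler1n expn_gt0.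
(* The lower bound on [D] passes to [Y] because [L] is a contraction. *)
have Y_ge : psdmx (1 + (2 * q%:R) *: Y).
  move=> x; rewrite qformD qformZ qform1 qform_congr.
  have := D_ge (L *m x); rewrite qformD qformZ qform1.
  have := L_contract x; lra.
have Y1_unit : 1 + Y \in unitmx.
  apply: (coercive_unitmx (c := 1 / 2)) => [|x]; first lra.
  have := Y_ge x; rewrite !qformD qformZ qform1.
  have := sqnorm_ge0 x; nra.
have invHD : invmx (H + D) = L *m Z *m L^T.
  have e : (H + D) *m (L *m Z *m L^T) = 1.
    have -> : (H + D) *m (L *m Z *m L^T) = V^T *m (1 + Y) *m Z *m L^T.
      rewrite !mulmxA; congr (_ *m _ *m _).
      rewrite mulmxDl mulmxDr mulmx1 VTVL; congr (_ + _).
      by rewrite /Y !mulmxA VTLT mul1mx.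
    by rewrite -(mulmxA V^T) mulmxV // mulmx1 VTLT.
  have [u _] := mulmx1_unit e.
  have := congr1 (mulmx (invmx (H + D))) e.
  by rewrite mulKmx // mulmx1 => <-.
have ql : q = (2 ^ m)%N.*2 by rewrite /q expnS mul2n.
have [k qk] : exists k, q = k.+1 by exists q.-1; rewrite prednK // expn_gt0.
have Bq : B ^+ q = L^T *m P ^+ k *m L.
  by rewrite qk expmxSr /B mulmxA mulmx_exp_shift LLT.
rewrite invHD.
have -> : \tr ((L *m Z *m L^T) ^+ q) = \tr ((B *m Z) ^+ q).
  by rewrite qk -mulmxA mxtrace_exp_mulC -mulmxA mxtrace_exp_mulC.
have symZ : Z^T = Z by rewrite trmx_inv linearD /= symY [1^T]trmx1.
apply: le_trans (mxtrace_Lieb_Thirring m.+1 symB symZ) _; rewrite -/q.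
have -> : \tr (P ^+ q) = \tr (B ^+ q) by rewrite qk /B -LLT mxtrace_exp_mulC.
have Pq : P ^+ q.+1 = P *m P ^+ k *m P by rewrite qk expmxSr expmxS.
have YB : Y *m B ^+ q = L^T *m (D *m P *m P ^+ k *m L).
  by rewrite Bq /Y !mulmxA -(mulmxA _ L) LLT.
have -> : \tr (D *m P ^+ q.+1) = \tr (Y *m B ^+ q).
  by rewrite YB [RHS]mxtrace_mulC -(mulmxA _ L) LLT Pq !mulmxA.
(* Since [P] is below the identity, [D *m P *m D] is below [D *m D]; the odd power [P ^+ q.+1] is a
   Gram matrix, so the traces compare. *)
have DPD : \tr (Y ^+ 2 *m B ^+ q) <= \tr (D *m D *m P ^+ q.+1).
  have -> : \tr (Y ^+ 2 *m B ^+ q) = \tr (D *m P *m D *m P ^+ q.+1).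
    rewrite expmx2 -mulmxA YB [in LHS]/Y mulmxA -(mulmxA _ L) LLT -!mulmxA.
    by rewrite mxtrace_mulC !mulmxA -(mulmxA _ L) LLT Pq !mulmxA.
  rewrite -subr_ge0 -linearB /= -mulmxBl ql exp_inv_gram.
  apply: mxtrace_mul_gram_ge0 => x.
  rewrite qformB -{1}symD qform_gram -{2}symD qform_congr subr_ge0.
  exact: P_le1.
have := Bernoulli_inverse symY (l := (2 ^ m)%N) _ _ (Z := Z).
rewrite -ql expn_gt0 mulVmx // => /(_ isT Y_ge erefl) F_ge.
(* [B ^+ q] is the Gram matrix of its half power, so Bernoulli's inequality can be traced against
   it. *)
have := mxtrace_mul_gram_ge0 (B ^+ (2 ^ m)) F_ge.
rewrite trmx_exp symB -[_ *m B ^+ _]/(_ * _) -exprD addnn -ql.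
rewrite mulmxBl mulmxDl mulmxBl mul1mx -!scalemxAl.
rewrite linearB /= linearD /= linearB /= !linearZ /= [\tr (Z ^+ q *m _)]mxtrace_mulC.
have : 0 <= 2 * q%:R ^+ 2 :> R by rewrite mulr_ge0 // sqr_ge0.
move: DPD; set a := \tr _; set b := \tr _; set c := 2 * _.
move=> h1 h2; have := ler_wpM2l h2 h1; lra.
Qed.

End ResolventPowers.

(** * Averaged decrease of the trace potential, and its size at a small Rayleigh quotient *)

Section ResolventStep.
Variables (R : realType) (r N : nat) (V : 'M[R]_(N.+1, r)).
Let H : 'M[R]_r := V^T *m V.
Hypothesis H_ge1 : forall x, sqnorm x <= qform H x.

(** The last hypothesis says that on average [2 q D^2] is below [D]; traced against [P ^+ q.+1],
    this makes the first-order gain outweigh the second-order loss of the perturbation bound. *)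
Lemma mxtrace_inv_step (m : nat) (I : finType) (S : pred I) (w : I -> R) (D : I -> 'M[R]_r) :
  let q := (2 ^ m.+1)%N in
  (forall i, S i -> 0 <= w i) -> (forall i, S i -> (D i)^T = D i) ->
  (forall i, S i -> psdmx (1 + (2 * q%:R) *: D i)) ->
  (forall x, \sum_(i | S i) w i * (2 * q%:R * sqnorm (D i *m x))
               <= \sum_(i | S i) w i * qform (D i) x) ->
  \sum_(i | S i) w i * \tr (invmx (H + D i) ^+ q)
    <= (\sum_(i | S i) w i) * \tr (invmx H ^+ q).
Proof.
move=> q w0 symD D_ge hD.
have uH := gram_unitmx H_ge1.
have symH : H^T = H by rewrite /H trmx_mul trmxK.
set P := invmx H; pose L := P *m V^T.
have symP : P^T = P by rewrite trmx_inv symH.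
have P_le1 : forall x, qform P x <= sqnorm x by apply: qform_inv_le.
have LT : L^T = V *m P by rewrite /L trmx_mul trmxK symP.
have LLT : L *m L^T = P by rewrite LT /L mulmxA -(mulmxA P) -/H mulVmx // mul1mx.
have VTLT : V^T *m L^T = 1 by rewrite LT mulmxA mulmxV.
have VTVL : V^T *m V *m L = V^T by rewrite /L mulmxA mulmxV // mul1mx.
pose E i := (2 * q%:R ^+ 2) *: (D i *m D i) - q%:R *: D i.
have ql : q = (2 ^ m)%N.*2 by rewrite /q expnS mul2n.
have step i : S i -> w i * \tr (invmx (H + D i) ^+ q)
    <= w i * \tr (P ^+ q) + w i * \tr (E i *m P ^+ q.+1).
  move=> Si; rewrite -mulrDr; apply: ler_wpM2l; first exact: w0.
  apply: le_trans (mxtrace_inv_perturb symP P_le1 LLT VTLT VTVL (symD i Si) (D_ge i Si)) _.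
  rewrite /E mulmxBl -!scalemxAl linearB /= !linearZ /= -/q; lra.
apply: le_trans (ler_sum _ step) _.
rewrite big_split /= -mulr_suml gerDl.
have -> : \sum_(i | S i) w i * \tr (E i *m P ^+ q.+1)
        = - \tr ((\sum_(i | S i) - (w i *: E i)) *m P ^+ q.+1).
  rewrite mulmx_suml linear_sum -sumrN; apply: eq_bigr => i _.
  by rewrite mulNmx -scalemxAl linearN linearZ opprK.
rewrite oppr_le0 ql (exp_inv_gram symP LLT); apply: mxtrace_mul_gram_ge0 => x.
rewrite qform_sum.
have -> : \sum_(i | S i) qform (- (w i *: E i)) x
  = q%:R * (\sum_(i | S i) w i * qform (D i) x
            - \sum_(i | S i) w i * (2 * q%:R * sqnorm (D i *m x))).
  rewrite -sumrB mulr_sumr; apply: eq_bigr => i Si.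
  rewrite qformN qformZ qformB !qformZ -{1}(symD i Si) qform_gram; ring.
by rewrite mulr_ge0 // subr_ge0.
Qed.

(** Repeated squaring with Cauchy-Schwarz carries the Rayleigh quotient of [x] from [H] to the
    dyadic powers of its inverse. The trace, a squared Frobenius norm of the half power, dominates
    that quotient. *)
Lemma mxtrace_inv_exp_ge (m : nat) (h : R) (x : 'cV[R]_r) :
  x != 0 -> 0 < h -> qform H x <= h * sqnorm x ->
  h^-1 ^+ (2 ^ m.+1) <= \tr (invmx H ^+ (2 ^ m.+1)).
Proof.
move=> x0 h0 Hx.
have uH := gram_unitmx H_ge1.
have symP : (invmx H)^T = invmx H by rewrite trmx_inv /H trmx_mul trmxK.
set P := invmx H in symP *.
have s0 : 0 < sqnorm x.
  rewrite lt_def sqnorm_ge0 andbT; apply: contra x0 => /eqP /sqnorm_eq0 ->; exact: eqxx.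
have hi0 : 0 <= h^-1 by rewrite invr_ge0 ltW.
have sq l : sqnorm (P ^+ l *m x) = qform (P ^+ l.*2) x.
  rewrite -qform_gram trmx_exp symP -addnn exprD //.
have low l : h^-1 ^+ (2 ^ l) * sqnorm x <= qform (P ^+ (2 ^ l)) x.
  elim: l => [|l IH].
    rewrite !expr1.
    (* The inner product of these two vectors is [sqnorm x]. *)
    have := Cauchy_Schwarz (V *m x) (V *m (P *m x)).
    rewrite -!qform_gram -/H trmx_mul !mulmxA -(mulmxA _ V^T) -/H -(mulmxA _ H) mulmxV //.
    rewrite mulmx1 -sqnormE -[qform H (P *m x)]qform_congr symP mulVmx // mul1mx => CS.
    rewrite mulrC ler_pdivrMr //.
    have Hp : 0 <= qform P x.
      have := H_ge1 (P *m x); rewrite -qform_congr symP mulVmx // mul1mx.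
      exact/le_trans/sqnorm_ge0.
    have : sqnorm x ^+ 2 <= sqnorm x * (qform P x * h) by nra.
    by rewrite expr2 ler_pM2l.
  have := Cauchy_Schwarz x (P ^+ (2 ^ l) *m x).
  rewrite mulmxA -/(qform _ _) sq -mul2n -expnS => CS.
  have : (h^-1 ^+ (2 ^ l) * sqnorm x) ^+ 2 <= (qform (P ^+ (2 ^ l)) x) ^+ 2.
    rewrite ler_sqr ?nnegrE //; last apply: le_trans IH.
      by rewrite mulr_ge0 ?exprn_ge0 // ltW.
    by rewrite mulr_ge0 ?exprn_ge0 // ltW.
  move/le_trans/(_ CS); rewrite exprMn -exprM -expnSr expr2 mulrA [_ * _ * sqnorm x]mulrC.
  by rewrite ler_pM2l.
have := low m.+1.
rewrite expnS mul2n -sq => {}low.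
rewrite -(ler_pM2r s0); apply: le_trans low _.
have -> : P ^+ (2 ^ m).*2 = P ^+ (2 ^ m) *m (P ^+ (2 ^ m))^T.
  by rewrite trmx_exp symP -addnn exprD.
move: (P ^+ (2 ^ m)) => M.
rewrite mxtrace_mul_tr mulr_suml; apply: ler_sum => i _.
have := Cauchy_Schwarz (row i M)^T x; rewrite trmxK -row_mul mxE.
congr (_ <= _ * _); apply: eq_bigr => j _; by rewrite !mxE.
Qed.

End ResolventStep.

(** * Weighted Gram matrices of the rows of [U] *)

Section WeightedGram.
Variables (R : realType) (n r : nat) (U : 'M[R]_(n, r)).

Definition wgram (h : 'I_n -> R) : 'M[R]_r := \sum_j h j *: ((row j U)^T *m row j U).

Lemma wgramE h a b : wgram h a b = \sum_j h j * (U j a * U j b).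
Proof.
rewrite /wgram summxE; apply: eq_bigr => j _.
by rewrite !mxE big_ord1 !mxE.
Qed.

Lemma trmx_wgram h : (wgram h)^T = wgram h.
Proof. by apply/matrixP => a b; rewrite mxE !wgramE; apply: eq_bigr => j _; ring. Qed.

Lemma wgramD h h' : wgram (fun j => h j + h' j) = wgram h + wgram h'.
Proof.
by apply/matrixP => a b; rewrite mxE !wgramE -big_split; apply: eq_bigr => j _ /=; ring.
Qed.

Lemma qform_wgram h x : qform (wgram h) x = \sum_j h j * (U *m x) j 0 ^+ 2.
Proof.
rewrite /wgram qform_sum; apply: eq_bigr => j _.
by rewrite qformZ qform_gram /sqnorm big_ord1 -row_mul mxE.
Qed.

Lemma wgram_factor h : (forall j, 0 <= h j) ->
  exists (N : nat) (V : 'M[R]_(N.+1, r)), V^T *m V = 1 + wgram h.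
Proof.
move=> h0.
pose W : 'M[R]_(n, r) := \matrix_(j, l) (Num.sqrt (h j) * U j l).
(* The zero row makes the number of rows a successor, as matrix polynomials require. *)
pose V : 'M[R]_(1 + (r + n), r) := col_mx 0 (col_mx 1%:M W).
suff : V^T *m V = 1 + wgram h by exists (r + n)%N, V.
rewrite tr_col_mx mul_row_col mulmx0 add0r tr_col_mx mul_row_col mulmx1 trmx1.
congr (_ + _); apply/matrixP => a b; rewrite wgramE !mxE; apply: eq_bigr => j _.
by rewrite !mxE mulrACA -expr2 sqr_sqrtr.
Qed.

Lemma leverage_ge0 j : 0 <= leverage U j.
Proof. by apply: sumr_ge0 => l _; apply: sqr_ge0. Qed.

Lemma sqr_mul_le_leverage (x : 'cV[R]_r) j : (U *m x) j 0 ^+ 2 <= leverage U j * sqnorm x.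
Proof.
have := Cauchy_Schwarz (row j U)^T x; rewrite trmxK -row_mul mxE.
by congr (_ <= _ * _); apply: eq_bigr => l _; rewrite !mxE.
Qed.

Section SmallWeights.
Variables (b : 'I_n -> R) (B : R).
Hypotheses (B_gt0 : 0 < B) (b_small : \sum_j `|b j| * leverage U j <= B).

Lemma abs_wgram_le (x : 'cV[R]_r) :
  \sum_j `|b j| * (U *m x) j 0 ^+ 2 <= B * sqnorm x.
Proof.
apply: le_trans (ler_wpM2r (sqnorm_ge0 x) b_small).
rewrite mulr_suml; apply: ler_sum => j _; rewrite -mulrA.
by apply: ler_wpM2l => //; apply: sqr_mul_le_leverage.
Qed.

(** For [z = wgram b *m x], the norm of [z] is a bilinear form in [U *m x] and [U *m z]. The
    arithmetic-geometric mean inequality with weight [B] separates them, and the [z] part, at most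
    [sqnorm z], is absorbed on the left. *)
Lemma sqnorm_wgram_le (x : 'cV[R]_r) :
  sqnorm (wgram b *m x) <= B * \sum_j `|b j| * (U *m x) j 0 ^+ 2.
Proof.
set z := wgram b *m x.
have zE : sqnorm z = \sum_j b j * ((U *m x) j 0 * (U *m z) j 0).
  rewrite sqnormE {2}/z; move: z => z.
  rewrite mulmxA /wgram mulmx_sumr mulmx_suml summxE.
  apply: eq_bigr => j _; rewrite -scalemxAr -scalemxAl mxE; congr (_ * _).
  rewrite !mulmxA -trmx_mul -(mulmxA _ _ x) -!row_mul mxE big_ord1.
  by rewrite [(row j _)^T _ _]mxE ![row j _ _ _]mxE mulrC.
have : 2 * sqnorm z <= \sum_j (B * (`|b j| * (U *m x) j 0 ^+ 2)
                                + B^-1 * (`|b j| * (U *m z) j 0 ^+ 2)).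
  rewrite zE mulr_sumr; apply: ler_sum => j _.
  move: ((U *m x) j 0) ((U *m z) j 0) => s t.
  have st : 2 * `|s * t| <= B * s ^+ 2 + B^-1 * t ^+ 2.
    rewrite -subr_ge0.
    have -> : B * s ^+ 2 + B^-1 * t ^+ 2 - 2 * `|s * t| = B^-1 * (B * `|s| - `|t|) ^+ 2.
      rewrite -[s ^+ 2]real_normK ?num_real // -[t ^+ 2]real_normK ?num_real // normrM.
      by field; rewrite gt_eqF.
    by rewrite mulr_ge0 ?sqr_ge0 // invr_ge0 ltW.
  have := ler_wpM2l (normr_ge0 (b j)) st.
  have : b j * (s * t) <= `|b j| * `|s * t| by rewrite -normrM ler_norm.
  lra.
rewrite big_split /= -!mulr_sumr.
have := ler_wpM2l (ltW (_ : 0 < B^-1)) (abs_wgram_le z).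
rewrite invr_gt0 => /(_ B_gt0); rewrite mulrA mulVf ?gt_eqF // mul1r; lra.
Qed.

End SmallWeights.
End WeightedGram.

(** * Conditioning a homogeneous measure on selected indices *)

Section HomogeneousMeasure.
Variables (R : realType) (n k : nat) (mu : {ffun 'I_n -> bool} -> R).
Hypotheses (mu_distr : is_distr mu) (mu_hom : homogeneous mu k).

Definition supp (w : {ffun 'I_n -> bool}) : {set 'I_n} := [set i | w i].

Definition upmass (S : {set 'I_n}) : R := \sum_(w | S \subset supp w) mu w.

(* The value is 0 when [upmass S] vanishes. *)
Definition cprob (S : {set 'I_n}) (j : 'I_n) : R := upmass (j |: S) / upmass S.

Let mu_ge0 w : 0 <= mu w := mu_distr.1 w.

Lemma allOnesE S w : `[< allOnes S w >] = (S \subset supp w).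
Proof.
apply/asboolP/subsetP => h i /h; first by rewrite inE.
by rewrite inE.
Qed.

Lemma Pr_allOnes S : Pr mu (allOnes S) = upmass S.
Proof. by apply: eq_bigl => w; rewrite allOnesE. Qed.

Lemma Pr_allOnesU1 i S : Pr mu (fun w => w i /\ allOnes S w) = upmass (i |: S).
Proof.
apply: eq_bigl => w; rewrite -allOnesE; apply: asbool_equiv_eq; split.
  by move=> [wi wS] l /setU1P [->|/wS].
by move=> h; split=> [|l lS]; apply: h; rewrite !inE ?eqxx // lS orbT.
Qed.

Lemma influenceE S i j : influence mu S i j = cprob (i |: S) j - cprob S j.
Proof.
rewrite /influence /condPr /cprob Pr_allOnes !Pr_allOnesU1; congr (_ / _ - _).
rewrite -Pr_allOnesU1; apply: eq_bigl => w; apply: asbool_equiv_eq; split.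
  by move=> [wj [wi wS]]; split=> // l /setU1P [->|/wS].
move=> [wj wS]; split=> //; split; first by apply: wS; rewrite setU11.
by move=> l lS; apply: wS; rewrite inE lS orbT.
Qed.

Lemma upmass_ge0 S : 0 <= upmass S.
Proof. exact: sumr_ge0. Qed.

Lemma upmass0 : upmass set0 = 1.
Proof. by rewrite -mu_distr.2; apply: eq_bigl => w; rewrite sub0set. Qed.

Lemma upmassS (S T : {set 'I_n}) : S \subset T -> upmass T <= upmass S.
Proof.
move=> ST; rewrite /upmass [leRHS](bigID (fun w => T \subset supp w)) /=.
rewrite [X in _ <= X + _](eq_bigl (fun w => T \subset supp w)) ?lerDl ?sumr_ge0 // => w.
by apply/andP/idP => [[]|h] //; split=> //; apply: subset_trans ST h.
Qed.

Lemma upmass_gt0S (S T : {set 'I_n}) : S \subset T -> 0 < upmass T -> 0 < upmass S.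
Proof. by move=> /upmassS h1 h2; apply: lt_le_trans h2 h1. Qed.

Lemma cprob_ge0 S j : 0 <= cprob S j.
Proof. by rewrite divr_ge0 ?upmass_ge0. Qed.

Lemma cprob_in S j : 0 < upmass S -> j \in S -> cprob S j = 1.
Proof. move=> S0 jS; rewrite /cprob (setUidPr _) ?sub1set //.
by rewrite divff ?gt_eqF. Qed.

Lemma cprob_gt0 S j : 0 < cprob S j -> 0 < upmass (j |: S).
Proof.
move=> h; rewrite lt_def upmass_ge0 andbT; apply/eqP => e.
by rewrite /cprob e mul0r ltxx in h.
Qed.

(** Both sides are the conditional probability that [i] and [j] are selected. This symmetry later
    turns row bounds on influences into column bounds. *)
Lemma cprobC S i j : 0 < upmass S ->
  cprob S i * cprob (i |: S) j = cprob S j * cprob (j |: S) i.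
Proof.
suff e i' j' : 0 < upmass S -> cprob S i' * cprob (i' |: S) j' = upmass (j' |: (i' |: S)) / upmass S.
  by move=> S0; rewrite !e // setUCA.
move=> S0; rewrite /cprob.
have [e|ne] := eqVneq (upmass (i' |: S)) 0; last by field; rewrite gt_eqF.
have -> : upmass (j' |: (i' |: S)) = 0.
  by apply/le_anti; rewrite upmass_ge0 -e upmassS // subsetUr.
by rewrite !mul0r mulr0.
Qed.

Lemma upmass_diff S j :
  upmass S = upmass (j |: S) + \sum_(w | (S \subset supp w) && ~~ w j) mu w.
Proof.
rewrite /upmass [LHS](bigID (fun w : {ffun 'I_n -> bool} => w j)) /=; congr (_ + _).
by apply: eq_bigl => w; rewrite subUset sub1set inE andbC.
Qed.

Lemma cprob_almost_sure S j : upmass [set j] = 1 -> 0 < upmass S -> cprob S j = 1.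
Proof.
move=> j1 S0; suff e : upmass S = upmass (j |: S) by rewrite /cprob -e divff ?gt_eqF.
rewrite (upmass_diff S j) big1 ?addr0 // => w /andP [_ wj].
have := upmass_diff set0 j; rewrite upmass0 setU0 j1 => /eqP.
rewrite -{1}[1]addr0 (inj_eq (addrI _)) eq_sym psumr_eq0 // => /allP /(_ w).
by rewrite mem_index_enum sub0set wj => /(_ isT) /eqP.
Qed.

(** By homogeneity no outcome of positive mass has a support strictly containing [supp w]. *)
Lemma cprob_supp w j : 0 < mu w -> cprob (supp w) j = (w j)%:R.
Proof.
move=> w0; have S0 : 0 < upmass (supp w).
  by rewrite /upmass (bigD1 w) //= ltr_wpDr ?sumr_ge0.
case wj: (w j); first by rewrite cprob_in // inE wj.
rewrite /cprob [upmass (j |: _)]big1 ?mul0r // => w' jw.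
apply/eqP; apply: contraT => w'0.
have := subset_leq_card jw.
have cw : #|supp w| = k by apply: mu_hom.
have -> : #|supp w'| = k by apply: mu_hom; rewrite lt_def w'0 mu_ge0.
by rewrite cardsU1 cw inE wj ltnn.
Qed.

(** Double counting: an outcome of positive mass whose support contains [S] has [k - #|S|] further
    selected indices. *)
Lemma sum_upmass_ext (f : {ffun 'I_n -> bool} -> R) (S : {set 'I_n}) :
  \sum_(i | i \notin S) \sum_(w | i |: S \subset supp w) mu w * f w
  = (k%:R - #|S|%:R) * \sum_(w | S \subset supp w) mu w * f w.
Proof.
rewrite (exchange_big_dep (fun w => S \subset supp w)) /=; last first.
  by move=> i w _; apply: subset_trans; apply: subsetUr.
rewrite mulr_sumr; apply: eq_bigr => w Sw.
have [->|mu0] := eqVneq (mu w) 0; first by rewrite mul0r mulr0 big1.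
rewrite sumr_const -[LHS]mulr_natl; congr (_ * _).
have <- : #|supp w| = k by apply: mu_hom; rewrite lt_def mu0 mu_ge0.
rewrite -natrB ?subset_leq_card // -cardsDS //; congr _%:R.
by apply: eq_card => i; rewrite [LHS]unfold_in /= subUset sub1set Sw andbT !inE.
Qed.

Lemma sum_cprob S : 0 < upmass S ->
  \sum_(i | i \notin S) cprob S i = k%:R - #|S|%:R.
Proof.
move=> S0; have := sum_upmass_ext (fun=> 1) S.
under eq_bigr do under eq_bigr do rewrite mulr1.
under [X in _ = _ * X]eq_bigr do rewrite mulr1.
rewrite -/(upmass S) /cprob -mulr_suml => ->.
by rewrite mulfK // gt_eqF.
Qed.

(** The martingale property of [cprob] when a uniformly chosen further selected index is
    revealed. *)
Lemma sum_cprob_mul S j : 0 < upmass S ->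
  \sum_(i | i \notin S) cprob S i * cprob (i |: S) j = (k%:R - #|S|%:R) * cprob S j.
Proof.
move=> S0; have e (T : {set 'I_n}) : \sum_(w | T \subset supp w) mu w * (w j)%:R = upmass (j |: T).
  rewrite /upmass [LHS](bigID (fun w : {ffun 'I_n -> bool} => w j)) /= [X in _ + X]big1 => [|w /andP [_ /negPf ->]].
    rewrite addr0; apply: eq_big => [w|w /andP [_ ->]]; last by rewrite mulr1.
    by rewrite subUset sub1set inE andbC.
  by rewrite mulr0.
have := sum_upmass_ext (fun w => (w j)%:R) S.
rewrite e => h; rewrite {2}/cprob mulrA -h mulr_suml; apply: eq_bigr => i _.
rewrite cprobC // e /cprob.
have [z|nz] := eqVneq (upmass (j |: S)) 0; last first.
  by rewrite setUCA; field; rewrite nz gt_eqF.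
have -> : upmass (j |: (i |: S)) = 0.
  by apply/le_anti; rewrite upmass_ge0 -z upmassS // setUS // subsetUr.
by rewrite z !mul0r.
Qed.

Lemma sum_cprob_pos (S : {set 'I_n}) (F : 'I_n -> R) :
  \sum_(i | (i \notin S) && (0 < cprob S i)) cprob S i * F i
    = \sum_(i | i \notin S) cprob S i * F i.
Proof.
rewrite big_mkcondr /=; apply: eq_bigr => i _; case: ltrP => // h.
by rewrite (_ : cprob S i = 0) ?mul0r //; apply/le_anti; rewrite h cprob_ge0.
Qed.

(** Reveal the selected indices one by one in uniformly random order: given [S], the next is [i]
    with probability proportional to [cprob S i]. The hypothesis makes [Phi] a supermartingale along
    this process, which ends at [supp w]. *)
Lemma top_down_bound (Phi : {set 'I_n} -> R) :
  (forall S : {set 'I_n}, 0 < upmass S ->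
     \sum_(i | (i \notin S) && (0 < cprob S i)) cprob S i * Phi (i |: S)
       <= (\sum_(i | (i \notin S) && (0 < cprob S i)) cprob S i) * Phi S) ->
  \sum_w mu w * Phi (supp w) <= Phi set0.
Proof.
move=> step.
(* [t] counts the indices still to be revealed; at [t = 0] homogeneity forces [supp w = S] on
   outcomes of positive mass. *)
have main t (S : {set 'I_n}) : (#|S| + t)%N = k ->
    \sum_(w | S \subset supp w) mu w * Phi (supp w) <= upmass S * Phi S.
  elim: t S => [|t IH] S; rewrite ?addn0 => cS.
    rewrite /upmass mulr_suml le_eqVlt; apply/orP; left; apply/eqP.
    apply: eq_bigr => w Sw; have [->|mu0] := eqVneq (mu w) 0; first by rewrite !mul0r.
    congr (_ * Phi _); apply/esym/eqP; rewrite eqEcard Sw cS.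
    suff -> : #|supp w| = k by rewrite leqnn.
    by apply: mu_hom; rewrite lt_def mu0 mu_ge0.
  have [S0|S0] := ltrP 0 (upmass S); last first.
    have z : upmass S = 0 by apply/le_anti; rewrite S0 upmass_ge0.
    have /allP zw : all (fun w => (S \subset supp w) ==> (mu w == 0)) (index_enum _).
      by rewrite -psumr_eq0 // -/(upmass S) z.
    rewrite z mul0r big1 // => w Sw.
    by have := zw w (mem_index_enum _); rewrite Sw => /eqP ->; rewrite mul0r.
  have kt : k%:R - #|S|%:R = t.+1%:R :> R by rewrite -cS natrD addrC addKr.
  have t0 : 0 < t.+1%:R :> R by rewrite ltr0n.
  have := sum_upmass_ext (fun w => Phi (supp w)) S; rewrite kt => e.
  rewrite -(ler_pM2l t0) -e.
  have /(ler_sum (index_enum _)) : forall i, i \notin S ->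
      \sum_(w | i |: S \subset supp w) mu w * Phi (supp w)
      <= upmass S * (cprob S i * Phi (i |: S)).
    move=> i iS; apply: le_trans (IH (i |: S) _) _; first by rewrite cardsU1 iS addSnnS.
    by rewrite mulrA /cprob [upmass S * _]mulrC divfK // gt_eqF.
  move/le_trans; apply; rewrite -mulr_sumr mulrCA (ler_pM2l S0).
  rewrite -sum_cprob_pos; apply: le_trans (step S S0) _.
  suff -> : \sum_(i | (i \notin S) && (0 < cprob S i)) cprob S i = t.+1%:R by [].
  rewrite -kt -sum_cprob //; have := sum_cprob_pos S (fun=> 1).
  by under eq_bigr do rewrite mulr1; move=> ->; apply: eq_bigr => i _; rewrite mulr1.
suff : \sum_(w | set0 \subset supp w) mu w * Phi (supp w) <= upmass set0 * Phi set0.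
  rewrite upmass0 mul1r; apply: le_trans; rewrite le_eqVlt; apply/orP; left.
  by apply/eqP/eq_bigl => w; rewrite sub0set.
by apply: (main k); rewrite cards0.
Qed.

End HomogeneousMeasure.

(** * The potential and the lower tail of the sketched Gram matrix *)

Section LowerTail.
Variables (R : realType) (D : R) (n r k : nat) (U : 'M[R]_(n, r)).
Variables (mu : {ffun 'I_n -> bool} -> R) (c : R).
Hypotheses (D_ge1 : 1 <= D) (U_orth : U^T *m U = 1%:M).
Hypotheses (mu_distr : is_distr mu) (mu_hom : homogeneous mu k).
Hypotheses (mu_indep : one_sided_linf_indep mu D) (c_gt0 : 0 < c).
Hypothesis mu_marg : forall i, Pr mu (fun w => w i) = ptilde U c i.

Let p (i : 'I_n) : R := ptilde U c i.

Lemma ptilde_ge0 i : 0 <= p i.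
Proof. by rewrite le_min ler01 mulr_ge0 ?leverage_ge0 // ltW. Qed.

Lemma ptilde_lt1 i : p i < 1 -> leverage U i = p i / c.
Proof.
rewrite /p /ptilde minElt; case: (ltrP 1 (c * leverage U i)) => [_|_ _]; first by rewrite ltxx.
by field; rewrite gt_eqF.
Qed.

Lemma ptilde_eq0 i a : p i = 0 -> U i a = 0.
Proof.
move=> p0; have := @ptilde_lt1 i; rewrite p0 ltr01 mul0r => /(_ isT) /eqP.
rewrite psumr_eq0 => [/allP /(_ a)|l _]; last exact: sqr_ge0.
by rewrite mem_index_enum sqrf_eq0 => /(_ isT) /eqP.
Qed.

Lemma upmass_set1 i : upmass mu [set i] = p i.
Proof.
rewrite /p -mu_marg /Pr; apply: eq_bigl => w.
by rewrite sub1set inE asboolb.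
Qed.

Lemma cprob_set0 i : cprob mu set0 i = p i.
Proof. by rewrite /cprob upmass0 // divr1 setU0 upmass_set1. Qed.

Let D_ge0 : 0 <= D.
Proof. exact: le_trans ler01 D_ge1. Qed.

Let sum_delta i : \sum_(j < n) (j == i)%:R = 1 :> R.
Proof. by rewrite (bigD1 i) //= eqxx big1 ?addr0 // => j /negPf ->. Qed.

(* For [p j = 0] the weight is 0, harmlessly, since row [j] of [U] vanishes then. *)
Let hw (S : {set 'I_n}) (j : 'I_n) : R :=
  (3 / 4 * cprob mu S j + 1 / 4 * ((j \in S) && (p j < 1))%:R) / p j.

(** This is [p j] times the increment of the weight [hw] at [j] when [i] is revealed. *)
Let alpha (S : {set 'I_n}) (i j : 'I_n) : R :=
  3 / 4 * influence mu S i j + 1 / 4 * ((j == i) && (p j < 1))%:R.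

Let hw_ge0 S j : 0 <= hw S j.
Proof.
rewrite divr_ge0 ?ptilde_ge0 //.
have := cprob_ge0 mu_distr S j; have := ler0n R ((j \in S) && (p j < 1)); lra.
Qed.

Let hwU1 (S : {set 'I_n}) i j : i \notin S -> hw (i |: S) j = hw S j + alpha S i j / p j.
Proof.
move=> iS; rewrite /hw /alpha influenceE -mulrDl; congr (_ / _).
rewrite in_setU1; have [->|ji] := eqVneq j i; last by rewrite /=; ring.
by rewrite (negPf iS) /=; ring.
Qed.

Let infl_eq0 (S : {set 'I_n}) i j : 0 < upmass mu (i |: S) -> (j \in S) || (p j == 1) ->
  influence mu S i j = 0.
Proof.
move=> iS0 js; have S0 : 0 < upmass mu S by apply: upmass_gt0S iS0; rewrite ?subsetUr.
rewrite influenceE; case/orP: js => [jS|/eqP p1].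
  by rewrite !cprob_in ?subrr // inE jS orbT.
by rewrite !cprob_almost_sure ?subrr // upmass_set1.
Qed.

Let alpha_eq0 (S : {set 'I_n}) i j : i \notin S -> 0 < upmass mu (i |: S) -> (j \in S) || (p j == 1) ->
  alpha S i j = 0.
Proof.
move=> iS iS0 js; rewrite /alpha infl_eq0 //.
suff -> : (j == i) && (p j < 1) = false by rewrite !mulr0 addr0.
case/orP: js => [jS|/eqP ->]; last by rewrite ltxx andbF.
by case: eqP => // ji; rewrite -ji jS in iS.
Qed.

Let infl_row (S : {set 'I_n}) i : i \notin S -> 0 < upmass mu (i |: S) ->
  \sum_j `|influence mu S i j| <= D.
Proof.
move=> iS iS0; have := mu_indep iS; rewrite Pr_allOnesU1 => /(_ iS0).
apply: le_trans; rewrite (bigID (fun j => j \in ~: S)) /= gerDl big1 // => j.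
by rewrite inE negbK => jS; rewrite infl_eq0 ?jS // normr0.
Qed.

Let alpha_abs S i j :
  `|alpha S i j| <= 3 / 4 * `|influence mu S i j| + 1 / 4 * (j == i)%:R.
Proof.
rewrite /alpha; apply: le_trans (ler_normD _ _) _.
have h3 : 0 <= 3 / 4 :> R by lra.
have h1 : 0 <= 1 / 4 :> R by lra.
rewrite (normrM (3 / 4)) (normrM (1 / 4)) (ger0_norm h3) (ger0_norm h1).
by rewrite normr_nat lerD2l ler_wpM2l ?ler_nat //; case: eqP; case: ltP.
Qed.

(** The weights [3 / 4] and [1 / 4] sum to 1, and [D >= 1] absorbs the indicator. *)
Let alpha_row (S : {set 'I_n}) i : i \notin S -> 0 < upmass mu (i |: S) -> \sum_j `|alpha S i j| <= D.
Proof.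
move=> iS iS0; apply: le_trans (ler_sum _ (fun j _ => alpha_abs S i j)) _.
rewrite big_split /= -!mulr_sumr sum_delta.
have h3 : 0 <= 3 / 4 :> R by lra.
apply: le_trans (lerD (ler_wpM2l h3 (infl_row iS iS0)) (lexx _)) _; have := D_ge1; lra.
Qed.

(** By [cprobC], [cprob S i] times the influence of [i] on [j] equals [cprob S j] times that of [j]
    on [i], so the column sum becomes a row sum. *)
Let alpha_col_abs (S : {set 'I_n}) j : 0 < upmass mu S ->
  \sum_(i | (i \notin S) && (0 < cprob mu S i)) cprob mu S i * `|alpha S i j|
    <= D * cprob mu S j.
Proof.
move=> S0; have [jS|jS] := boolP (j \in S).
  rewrite big1 => [|i /andP [iS /cprob_gt0 iS0]].
    by rewrite mulr_ge0 ?cprob_ge0.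
  by rewrite alpha_eq0 ?jS ?normr0 ?mulr0 // iS0.
have qj := cprob_ge0 mu_distr S j.
apply: (@le_trans _ _ (\sum_i cprob mu S j *
          (3 / 4 * `|influence mu S j i| + 1 / 4 * (i == j)%:R))).
  rewrite [leRHS](bigID (fun i => (i \notin S) && (0 < cprob mu S i))) /=.
  rewrite ler_wpDr ?sumr_ge0 // => [i _|].
    by rewrite mulr_ge0 // addr_ge0 // mulr_ge0 //; lra.
  apply: ler_sum => i _; apply: le_trans (ler_wpM2l (cprob_ge0 mu_distr S i) (alpha_abs S i j)) _.
  have e : cprob mu S i * `|influence mu S i j| = cprob mu S j * `|influence mu S j i|.
    rewrite -(ger0_norm (cprob_ge0 mu_distr S i)) -[X in _ = X * _](ger0_norm qj).
    rewrite -!normrM !influenceE !mulrBr (cprobC mu_distr i j S0); congr (`|_ - _|).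
    exact: mulrC.
  rewrite !mulrDr [_ * (3 / 4 * _)]mulrCA e [X in _ <= X + _]mulrCA lerD2l.
  by rewrite eq_sym; case: eqP => [->|]; rewrite ?mulr0.
rewrite -mulr_sumr mulrC; have [->|q0] := eqVneq (cprob mu S j) 0; first by rewrite !mulr0.
apply: ler_wpM2r => //; rewrite big_split /= -!mulr_sumr sum_delta.
have jS0 : 0 < upmass mu (j |: S) by apply: cprob_gt0 => //; rewrite lt_def q0.
have h3 : 0 <= 3 / 4 :> R by lra.
apply: le_trans (lerD (ler_wpM2l h3 (infl_row jS jS0)) (lexx _)) _; have := D_ge1; lra.
Qed.

(** The influence part averages to zero by the martingale property; what remains is the indicator at
    [i = j]. *)
Let alpha_drift (S : {set 'I_n}) j : 0 < upmass mu S -> j \notin S -> p j < 1 ->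
  \sum_(i | (i \notin S) && (0 < cprob mu S i)) cprob mu S i * alpha S i j
    = 1 / 4 * cprob mu S j.
Proof.
move=> S0 jS p1; rewrite (sum_cprob_pos mu_distr).
transitivity (3 / 4 * (\sum_(i | i \notin S) cprob mu S i * cprob mu (i |: S) j
    - (\sum_(i | i \notin S) cprob mu S i) * cprob mu S j)
    + 1 / 4 * \sum_(i | i \notin S) cprob mu S i * (j == i)%:R).
  rewrite mulr_suml -sumrB !mulr_sumr -big_split /=; apply: eq_bigr => i _.
  by rewrite /alpha influenceE p1 andbT; ring.
rewrite (sum_cprob_mul mu_distr mu_hom) // (sum_cprob mu_distr mu_hom) // subrr mulr0 add0r.
congr (_ * _); rewrite (bigD1 j) //= eqxx mulr1 big1 ?addr0 // => i /andP [_ ij].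
by rewrite eq_sym (negPf ij) mulr0.
Qed.

Variable m : nat.
Let q : nat := (2 ^ m.+1)%N.
Hypothesis c_large : 8 * q%:R * D ^+ 2 <= c.

Let Hm (S : {set 'I_n}) : 'M[R]_r := 1 + wgram U (hw S).
Let Phi (S : {set 'I_n}) : R := \tr (invmx (Hm S) ^+ q).

Let Hm_factor S : exists (N : nat) (V : 'M[R]_(N.+1, r)),
  V^T *m V = Hm S /\ forall x, sqnorm x <= qform (V^T *m V) x.
Proof.
have [N [V e]] := wgram_factor U (hw_ge0 S).
exists N, V; split=> // x; rewrite e qformD qform1 lerDl qform_wgram.
by apply: sumr_ge0 => j _; rewrite mulr_ge0 ?sqr_ge0.
Qed.

(** Where [p j < 1] the ratio of leverage to [p j] is [1 / c] or the row vanishes; where [p j = 1]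
    the increment vanishes. *)
Let alpha_small (S : {set 'I_n}) i : i \notin S -> 0 < upmass mu (i |: S) ->
  \sum_j `|alpha S i j / p j| * leverage U j <= D / c.
Proof.
move=> iS iS0; apply: le_trans (ler_wpM2r _ (alpha_row iS iS0)); last by rewrite invr_ge0 ltW.
rewrite mulr_suml; apply: ler_sum => j _.
have [p1|p1] := ltrP (p j) 1; last first.
  have pj1 : p j = 1 by apply/le_anti; rewrite p1 ge_min lexx.
  by rewrite alpha_eq0 ?pj1 ?eqxx ?orbT // !(mul0r, normr0).
rewrite ptilde_lt1 //; have [->|pn] := eqVneq (p j) 0.
  by rewrite !(mul0r, mulr0) mulr_ge0 // invr_ge0 ltW.
rewrite normrM normfV (ger0_norm (ptilde_ge0 j)).
by rewrite -mulrA (mulrA (_^-1)) mulVf // mul1r.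
Qed.

Let Phi_step (S : {set 'I_n}) : 0 < upmass mu S ->
  \sum_(i | (i \notin S) && (0 < cprob mu S i)) cprob mu S i * Phi (i |: S)
    <= (\sum_(i | (i \notin S) && (0 < cprob mu S i)) cprob mu S i) * Phi S.
Proof.
move=> S0; have [N [V [VE V1]]] := Hm_factor S.
pose Dm i := wgram U (fun j => alpha S i j / p j).
have B0 : 0 < D / c by rewrite divr_gt0 // (lt_le_trans ltr01).
have q0 : 0 <= q%:R :> R by [].
have := mxtrace_inv_step V1 (m := m) (S := fun i => (i \notin S) && (0 < cprob mu S i))
          (w := cprob mu S) (D := Dm).
rewrite VE -/q /= => /(_ (fun i _ => cprob_ge0 mu_distr S i)) /(_ (fun i _ => trmx_wgram _ _)).
have eH i : i \notin S -> Hm S + Dm i = Hm (i |: S).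
  move=> iS; rewrite /Hm /Dm -addrA -wgramD; congr (_ + wgram _ _).
  by apply/funext => j; rewrite hwU1.
move=> step; apply: le_trans (step _ _); first 1 last.
(* A single increment has quadratic form at least [- D / c] times [sqnorm x], and
   [2 q D / c <= 1]. *)
- move=> i /andP [iS /cprob_gt0 -/(_ mu_distr) iS0] x.
  rewrite qformD qform1 qformZ qform_wgram.
  have := abs_wgram_le (alpha_small iS iS0) x.
  have : - (\sum_j `|alpha S i j / p j| * (U *m x) j 0 ^+ 2)
         <= \sum_j alpha S i j / p j * (U *m x) j 0 ^+ 2.
    rewrite -sumrN; apply: ler_sum => j _; rewrite -mulNr ler_wpM2r ?sqr_ge0 //.
    by rewrite lerNl -normrN ler_norm.
  set u := \sum_j _; set v := \sum_j _ => h1 h2.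
  have small : 2 * q%:R * (D / c) <= 1.
    rewrite mulrA ler_pdivrMr // mul1r; apply: le_trans c_large.
    have : q%:R * D <= q%:R * D ^+ 2 by rewrite ler_wpM2l // expr2 ler_peMl.
    have : 0 <= q%:R * D by rewrite mulr_ge0.
    lra.
  have := ler_wpM2r (sqnorm_ge0 x) small.
  have := ler_wpM2l q0 h1; have := ler_wpM2l q0 h2.
  rewrite !mulrN !mulrA; lra.
(* Coordinate by coordinate, the second moment costs at most [2 q D^2 / c] times [cprob S j],
   whereas the drift is [1 / 4] of [cprob S j]; this is where [8 q D^2 <= c] is spent. *)
- move=> x.
  pose y j := (U *m x) j 0 ^+ 2 / p j.
  have y0 j : 0 <= y j by rewrite divr_ge0 ?sqr_ge0 ?ptilde_ge0.
  apply: (@le_trans _ _ (\sum_j y j * (2 * q%:R * (D / c) *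
     \sum_(i | (i \notin S) && (0 < cprob mu S i)) cprob mu S i * `|alpha S i j|))).
    under [leRHS]eq_bigr => j _ do rewrite mulr_sumr mulr_sumr.
    rewrite [leRHS]exchange_big /=.
    apply: ler_sum => i /andP [iS /cprob_gt0 -/(_ mu_distr) iS0].
    under [leRHS]eq_bigr => j _.
      have -> : y j * (2 * q%:R * (D / c) * (cprob mu S i * `|alpha S i j|)) =
        cprob mu S i * (2 * q%:R * ((D / c) * (`|alpha S i j / p j| * (U *m x) j 0 ^+ 2))).
        by rewrite /y normrM normfV (ger0_norm (ptilde_ge0 j)); ring.
      over.
    rewrite -!mulr_sumr ler_wpM2l ?cprob_ge0 // ler_wpM2l ?mulr_ge0 //.
    exact: sqnorm_wgram_le B0 (alpha_small iS iS0) x.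
  under [leRHS]eq_bigr => i _ do rewrite qform_wgram mulr_sumr.
  rewrite exchange_big /=; apply: ler_sum => j _.
  have -> : \sum_(i | (i \notin S) && (0 < cprob mu S i))
       cprob mu S i * (alpha S i j / p j * (U *m x) j 0 ^+ 2)
     = y j * \sum_(i | (i \notin S) && (0 < cprob mu S i)) cprob mu S i * alpha S i j.
    by rewrite mulr_sumr; apply: eq_bigr => i _; rewrite /y; ring.
  apply: ler_wpM2l => //.
  have [jS|] := boolP ((j \in S) || (p j == 1)).
    rewrite !big1 ?mulr0 // => i /andP [iS /cprob_gt0 -/(_ mu_distr) iS0].
      by rewrite alpha_eq0 // mulr0.
    by rewrite alpha_eq0 // normr0 mulr0.
  rewrite negb_or => /andP [jS p1].
  have {}p1 : p j < 1 by rewrite lt_def eq_sym p1 ge_min lexx.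
  rewrite alpha_drift //.
  have := alpha_col_abs j S0; set T := \sum_(i | _) _ => hT.
  have k0 : 0 <= 2 * q%:R * (D / c) by apply: mulr_ge0 (ltW B0); rewrite mulr_ge0.
  apply: le_trans (ler_wpM2l k0 hT) _; rewrite [leLHS]mulrA.
  apply: ler_wpM2r; first exact: cprob_ge0.
  have -> : 2 * q%:R * (D / c) * D = (2 * q%:R * D ^+ 2) / c by ring.
  by rewrite ler_pdivrMr //; have := c_large; lra.
apply: ler_sum => i /andP [iS _]; by rewrite eH.
Qed.

Let Phi_ge0 S : 0 <= Phi S.
Proof.
have symH : (Hm S)^T = Hm S.
  by rewrite /Hm linearD /= trmx_wgram; congr (_ + _); apply: trmx1.
have symP : (invmx (Hm S))^T = invmx (Hm S) by rewrite trmx_inv symH.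
rewrite /Phi /q expnS mul2n -addnn exprD -{2}symP -trmx_exp.
exact: mxtrace_mul_tr_ge0.
Qed.

Let Phi_set0 : Phi set0 = r%:R * (4 / 7) ^+ q.
Proof.
have -> : Phi set0 = \tr ((4 / 7 : R)%:M ^+ q : 'M[R]_r).
  rewrite /Phi; congr (\tr (_ ^+ q)).
  have -> : Hm set0 = (7 / 4)%:M.
    have -> : Hm set0 = 1%:M + (3 / 4) *: (U^T *m U).
      congr (_ + _); apply/matrixP => a b; rewrite wgramE !mxE mulr_sumr.
      apply: eq_bigr => j _; rewrite mxE /hw cprob_set0 inE /= mulr0 addr0.
      have [p0|pn] := eqVneq (p j) 0; first by rewrite !(ptilde_eq0 _ p0) !(mul0r, mulr0).
      by rewrite mulfK.
    rewrite U_orth scale_scalar_mx -raddfD mulr1; congr _%:M; lra.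
  rewrite invmx_scalar; congr _%:M; lra.
have -> : (4 / 7 : R)%:M ^+ q = ((4 / 7) ^+ q)%:M :> 'M[R]_r.
  elim: q => [|l IH]; first by rewrite !expr0.
  by rewrite expmxS IH -scalar_mxM -exprS.
by rewrite mxtrace_scalar [RHS]mulr_natl.
Qed.

Definition spectral_lower (w : {ffun 'I_n -> bool}) : Prop :=
  forall x : 'cV[R]_r, 1 / 2 * sqnorm x <= \sum_(j | w j) (U *m x) j 0 ^+ 2 / p j.

(** At a full outcome the weights [3 / 4] and [1 / 4] add up to at most 1, so a direction violating
    the bound has Rayleigh quotient below [3 / 2] for [Hm]. *)
Let Phi_large w : 0 < mu w -> ~ spectral_lower w -> (2 / 3) ^+ q <= Phi (supp w).
Proof.
move=> w0 /existsNP [x /negP]; rewrite -ltNge => hx.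
have [N [V [VE V1]]] := Hm_factor (supp w).
have x0 : x != 0.
  apply/eqP => x0; move: hx; have -> : sqnorm x = 0 by rewrite x0 sqnormE mulmx0 mxE.
  by rewrite mulr0 x0 mulmx0 big1 ?ltxx // => j _; rewrite mxE expr0n mul0r.
have -> : 2 / 3 = (3 / 2 : R)^-1 by rewrite invf_div.
rewrite /Phi -VE; apply: (mxtrace_inv_exp_ge V1 m x0); first lra.
rewrite VE qformD qform1 qform_wgram.
suff : \sum_j hw (supp w) j * (U *m x) j 0 ^+ 2 <= \sum_(j | w j) (U *m x) j 0 ^+ 2 / p j.
  by lra.
rewrite [leRHS]big_mkcond /=; apply: ler_sum => j _.
rewrite /hw (cprob_supp mu_distr mu_hom _ w0) inE; case: (w j) => /=; last first.
  by rewrite !(mulr0, addr0, mul0r).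
rewrite [leRHS]mulrC ler_wpM2r ?sqr_ge0 // ler_piMl ?invr_ge0 ?ptilde_ge0 //.
by case: (p j < 1); rewrite /= ?mulr1n ?mulr0n; lra.
Qed.

Lemma spectral_lower_tail :
  \sum_(w | `[< ~ spectral_lower w >]) mu w <= r%:R * (6 / 7) ^+ q.
Proof.
have t0 : 0 < (2 / 3 : R) ^+ q by rewrite exprn_gt0 //; lra.
rewrite -(ler_pM2l t0) mulrCA -exprMn.
have -> : 2 / 3 * (6 / 7) = 4 / 7 :> R by field.
rewrite -Phi_set0; apply: le_trans (top_down_bound mu_distr mu_hom Phi_step).
rewrite mulr_sumr [leRHS](bigID (fun w => `[< ~ spectral_lower w >])) /=.
apply: ler_wpDr; first by apply: sumr_ge0 => w _; rewrite mulr_ge0 // mu_distr.1.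
apply: ler_sum => w /asboolP hw'; rewrite mulrC.
have [->|w0] := eqVneq (mu w) 0; first by rewrite !mul0r.
have wp : 0 < mu w by rewrite lt_def w0 mu_distr.1.
by rewrite ler_wpM2l ?(ltW wp) //; apply: Phi_large.
Qed.

(** * Second moment of the cross term *)

Section CrossTerm.
Variable v : 'cV[R]_n.
Hypothesis v_orth : U^T *m v = 0.

Definition cross_term (w : {ffun 'I_n -> bool}) : 'cV[R]_r :=
  \col_a \sum_(j | w j) v j 0 / p j * U j a.

(** The singleton is written as a union with [set0] to match [influence] at the empty set. For
    [i = j] the union collapses and the value is the variance [p i - p i ^+ 2]. *)
Let cov i j : R := upmass mu (j |: (i |: set0)) - p i * p j.

Let covC i j : cov i j = cov j i.
Proof. by rewrite /cov setUCA [p i * _]mulrC. Qed.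

Let mean_ind i : \sum_w mu w * (w i)%:R = p i.
Proof.
rewrite -upmass_set1 /upmass [RHS]big_mkcond; apply: eq_bigr => w _.
by rewrite sub1set inE; case: (w i); rewrite ?mulr1 ?mulr0.
Qed.

Let covE i j : \sum_w mu w * (((w i)%:R - p i) * ((w j)%:R - p j)) = cov i j.
Proof.
transitivity (\sum_w (mu w * ((w i)%:R * (w j)%:R) - p j * (mu w * (w i)%:R)
     - p i * (mu w * (w j)%:R) + p i * p j * mu w)).
  by apply: eq_bigr => w _; ring.
rewrite big_split /= !sumrB -!mulr_sumr !mean_ind mu_distr.2.
have -> : \sum_w mu w * ((w i)%:R * (w j)%:R) = upmass mu (j |: (i |: set0)).
  rewrite /upmass [RHS]big_mkcond; apply: eq_bigr => w _.
  rewrite setU0 subUset !sub1set !inE.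
  by case: (w i); case: (w j); rewrite /= ?mulr1 ?mulr0.
by rewrite /cov; ring.
Qed.

(** For [p i > 0], [cov i j / p i] is the influence of [i] on [j] with nothing revealed. *)
Let cov_row i : \sum_j `|cov i j| / p i <= D.
Proof.
have [p0|pn] := eqVneq (p i) 0.
  by rewrite big1 // => j _; rewrite p0 invr0 mulr0.
have i0 : 0 < upmass mu (i |: set0).
  by rewrite setU0 upmass_set1 lt_def pn ptilde_ge0.
have := infl_row (S := set0) _ i0; rewrite in_set0 => /(_ isT).
congr (_ <= _); apply: eq_bigr => j _.
rewrite influenceE cprob_set0 /cprob -/(p j).
have -> : upmass mu (i |: set0) = p i by rewrite setU0 upmass_set1.
have -> : upmass mu (j |: (i |: set0)) / p i - p j = cov i j / p i.
  by rewrite /cov; field.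
by rewrite normrM normfV (ger0_norm (ptilde_ge0 i)).
Qed.

Let cov_eq0 i j : p i = 1 -> cov i j = 0.
Proof.
move=> pi1; rewrite /cov setUCA setU0 pi1 mul1r.
have [e|nz] := eqVneq (p j) 0.
  apply/eqP; rewrite e subr0 eq_le upmass_ge0 // andbT -e -upmass_set1.
  by rewrite upmassS // subsetUr.
have j0 : 0 < upmass mu [set j] by rewrite upmass_set1 lt_def nz ptilde_ge0.
have := cprob_almost_sure mu_distr (j := i) _ j0.
rewrite /cprob !upmass_set1 => /(_ pi1) e.
by rewrite -[upmass _ _](divfK nz) e mul1r subrr.
Qed.

(** Centering the indicators is free because [v] is orthogonal to the columns of [U]. *)
Let cross_termE w a : cross_term w a 0
  = \sum_j ((w j)%:R - p j) / p j * (v j 0 * U j a).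
Proof.
rewrite mxE big_mkcond /=.
have z : \sum_j v j 0 * U j a = 0.
  have := congr1 (fun M : 'cV_r => M a 0) v_orth; rewrite !mxE; apply: etrans.
  by apply: eq_bigr => j _; rewrite mxE mulrC.
rewrite -[RHS]addr0 -[X in _ + X]z -big_split /=; apply: eq_bigr => j _.
have [p0|pn] := eqVneq (p j) 0; first by rewrite (ptilde_eq0 _ p0) !mulr0 addr0 if_same.
by case: (w j); rewrite /= ?mulr1n ?mulr0n; field.
Qed.

Lemma cross_term_second_moment :
  \sum_w mu w * sqnorm (cross_term w) <= D / c * sqnorm v.
Proof.
pose T i j : R := \sum_a U i a * U j a.
have -> : \sum_w mu w * sqnorm (cross_term w)
    = \sum_i \sum_j cov i j / (p i * p j) * (v i 0 * v j 0 * T i j).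
  transitivity (\sum_w \sum_i \sum_j
     mu w * (((w i)%:R - p i) * ((w j)%:R - p j)) / (p i * p j) * (v i 0 * v j 0 * T i j)).
    apply: eq_bigr => w _; rewrite /sqnorm.
    under eq_bigr => a _ do rewrite cross_termE expr2 big_distrlr /=.
    rewrite exchange_big mulr_sumr /=; apply: eq_bigr => i _.
    rewrite exchange_big mulr_sumr /=; apply: eq_bigr => j _.
    rewrite /T !mulr_sumr; apply: eq_bigr => a _.
    by rewrite invfM; ring.
  rewrite exchange_big /=; apply: eq_bigr => i _.
  rewrite exchange_big /=; apply: eq_bigr => j _.
  by rewrite -!mulr_suml covE.
pose K i j : R := v i 0 ^+ 2 * (`|cov i j| / p i).
have K0 i j : 0 <= K i j by rewrite mulr_ge0 ?sqr_ge0 // divr_ge0 ?ptilde_ge0.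
have c0 : 0 <= (2 * c)^-1 by rewrite invr_ge0 mulr_ge0 // ltW.
have bound i j : cov i j / (p i * p j) * (v i 0 * v j 0 * T i j)
    <= (2 * c)^-1 * (K i j + K j i).
  have [pi1|pi1] := eqVneq (p i) 1.
    by rewrite cov_eq0 // !mul0r mulr_ge0 ?addr_ge0.
  have [pj1|pj1] := eqVneq (p j) 1.
    by rewrite covC cov_eq0 // !mul0r mulr_ge0 ?addr_ge0.
  have li : leverage U i = p i / c by apply: ptilde_lt1; rewrite lt_def eq_sym pi1 ge_min lexx.
  have lj : leverage U j = p j / c by apply: ptilde_lt1; rewrite lt_def eq_sym pj1 ge_min lexx.
  have [pi0|pin] := eqVneq (p i) 0.
    by rewrite pi0 mul0r invr0 mulr0 mul0r mulr_ge0 ?addr_ge0.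
  have [pj0|pjn] := eqVneq (p j) 0.
    by rewrite pj0 mulr0 invr0 mulr0 mul0r mulr_ge0 ?addr_ge0.
  (* Each residual entry is paired with the leverage of the other index: as leverage is [p / c]
     here, it cancels one factor of [p i * p j] and leaves the kernel [K]. *)
  have amgm : 2 * `|v i 0 * v j 0 * T i j| <= v j 0 ^+ 2 * leverage U i + v i 0 ^+ 2 * leverage U j.
    have pm (s : R) : s ^+ 2 = 1 -> 2 * (s * (v i 0 * v j 0 * T i j))
         <= v j 0 ^+ 2 * leverage U i + v i 0 ^+ 2 * leverage U j.
      move=> s2; have : 0 <= \sum_a (v j 0 * U i a + (- (s * v i 0)) * U j a) ^+ 2.
        by apply: sumr_ge0 => a _; apply: sqr_ge0.
      rewrite sum_sqr_lincomb -/(leverage U i) -/(leverage U j) -/(T i j).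
      by rewrite sqrrN exprMn s2 mul1r; lra.
    case: (ger0P (v i 0 * v j 0 * T i j)) => _.
      by have := pm 1 (expr1n _ 2); rewrite mul1r.
    by have := pm (-1); rewrite sqrrN expr1n mulN1r => /(_ erefl).
  have -> : (2 * c)^-1 * (K i j + K j i) = `|cov i j| / (p i * p j) *
       ((v j 0 ^+ 2 * leverage U i + v i 0 ^+ 2 * leverage U j) / 2).
    by rewrite li lj /K (covC j i); field; rewrite pin pjn gt_eqF.
  apply: le_trans (ler_norm _) _; rewrite normrM.
  have -> : `|cov i j / (p i * p j)| = `|cov i j| / (p i * p j).
    by rewrite normrM normfV (ger0_norm (mulr_ge0 (ptilde_ge0 i) (ptilde_ge0 j))).
  apply: ler_wpM2l; first by rewrite divr_ge0 // mulr_ge0 ?ptilde_ge0.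
  by rewrite ler_pdivlMr // mulrC.
apply: le_trans (ler_sum _ (fun i _ => ler_sum _ (fun j _ => bound i j))) _.
have KD : \sum_i \sum_j K i j <= D * sqnorm v.
  rewrite /sqnorm mulr_sumr; apply: ler_sum => i _; rewrite /K -mulr_sumr mulrC.
  by apply: ler_wpM2r; [apply: sqr_ge0 | apply: cov_row].
under eq_bigr do rewrite -mulr_sumr.
rewrite -mulr_sumr; under eq_bigr do rewrite big_split.
rewrite big_split /= [X in _ + X]exchange_big /=.
have -> : D / c * sqnorm v = (2 * c)^-1 * (D * sqnorm v + D * sqnorm v).
  by field; rewrite gt_eqF.
by rewrite ler_wpM2l // lerD.
Qed.

End CrossTerm.

End LowerTail.

(** * From the sketched problem to the excess risk *)

Section Regression.
Variable R : realType.

Lemma sqnorm_sketch (n : nat) (p : 'I_n -> R) (w : {ffun 'I_n -> bool}) (v : 'cV[R]_n) :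
  (forall i, 0 <= p i) -> sqnorm (sketch p w *m v) = \sum_(i | w i) v i 0 ^+ 2 / p i.
Proof.
move=> p0; rewrite -big_set /= big_enum_val /=; apply: eq_bigr => s _.
rewrite mxE (bigD1 (enum_val s)) //= mxE eqxx big1 => [|j /negPf js].
  by rewrite addr0 exprMn exprVn sqr_sqrtr // mulrC.
by rewrite mxE js mul0r.
Qed.

Lemma sqnorm_orth_sub (n r : nat) (U : 'M[R]_(n, r)) (z : 'cV[R]_r) (v : 'cV[R]_n) :
  U^T *m U = 1%:M -> U^T *m v = 0 -> sqnorm (U *m z - v) = sqnorm z + sqnorm v.
Proof.
move=> UU Uv.
have vU : v^T *m U = 0 by rewrite -[LHS]trmxK trmx_mul trmxK Uv trmx0.
rewrite !sqnormE [(_ - _)^T]linearB /= mulmxBl !mulmxBr trmx_mul.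
rewrite -(mulmxA _ _ v) Uv mulmx0 (mulmxA v^T) vU mul0mx.
rewrite mulmxA -(mulmxA z^T) UU mulmx1 !mxE; ring.
Qed.

Lemma sum_leverage (n r : nat) (U : 'M[R]_(n, r)) :
  U^T *m U = 1%:M -> \sum_i leverage U i = r%:R.
Proof.
move=> UU; rewrite -(mxtrace1 R r) -UU exchange_big /=; apply: eq_bigr => j _.
by rewrite mxE; apply: eq_bigr => i _; rewrite mxE expr2.
Qed.

Lemma orthonormal_basis_le (n d r : nat) (A : 'M[R]_(n, d)) (U : 'M[R]_(n, r)) :
  orthonormal_basis_of_colspan A U -> (r <= d)%N.
Proof.
move=> [UU /eqmxP UA].
have <- : \rank U^T = r by apply/eqP/row_freeP; exists U.
by rewrite UA rank_leq_row.
Qed.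

Lemma dot_cross_term (n r : nat) (U : 'M[R]_(n, r)) (c : R) (v : 'cV[R]_n) w (z : 'cV[R]_r) :
  (z^T *m cross_term U c v w) 0 0 = \sum_(j | w j) (U *m z) j 0 * v j 0 / ptilde U c j.
Proof.
rewrite mxE; under eq_bigr => a _ do rewrite !mxE mulr_sumr.
rewrite exchange_big /=; apply: eq_bigr => j _; rewrite mxE -[RHS]mulrA mulr_suml.
by apply: eq_bigr => a _; ring.
Qed.

Section SketchedSolution.
Variables (n d r : nat) (A : 'M[R]_(n, d)) (b : 'cV[R]_n) (U : 'M[R]_(n, r)).
Hypothesis AU : orthonormal_basis_of_colspan A U.
Let v : 'cV[R]_n := b - U *m (U^T *m b).

Lemma residual_orth : U^T *m v = 0.
Proof. by have [UU _] := AU; rewrite /v mulmxBr (mulmxA U^T U) UU mul1mx subrr. Qed.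

Let A_sub x : exists z, A *m x - b = U *m z - v.
Proof.
have [UU /eqmxP UA] := AU.
have /submxP [X AX] : (A^T <= U^T)%MS by rewrite UA.
have -> : A = U *m X^T by rewrite -[A]trmxK AX trmx_mul trmxK.
exists (X^T *m x - U^T *m b); rewrite mulmxBr /v !mulmxA opprB addrA subrK //.
Qed.

Lemma residual_min x : sqnorm v <= sqnorm (A *m x - b).
Proof.
have [z ->] := A_sub x; rewrite sqnorm_orth_sub ?residual_orth //; last exact: AU.1.
by rewrite lerDr sqnorm_ge0.
Qed.

(** Write [A *m x - b = U *m z - v]; the excess is [s = sqnorm z]. Sketched optimality and the
    spectral bound give [s / 2 <= 2 u] with [u] the inner product of [z] and the cross term;
    Cauchy-Schwarz then bounds [s]. *)
Lemma sketched_excess (c : R) (w : {ffun 'I_n -> bool}) (x : 'cV[R]_d) :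
  0 < c -> spectral_lower U c w ->
  (forall x', sqnorm (sketch (ptilde U c) w *m A *m x - sketch (ptilde U c) w *m b)
    <= sqnorm (sketch (ptilde U c) w *m A *m x' - sketch (ptilde U c) w *m b)) ->
  sqnorm (A *m x - b) <= sqnorm v + 16 * sqnorm (cross_term U c v w).
Proof.
move=> c0 low opt; have [UU /eqmxP UA] := AU.
have /submxP [Y UY] : (U^T <= A^T)%MS by rewrite UA.
have [z ez] := A_sub x.
have p0 i : 0 <= ptilde U c i by apply: ptilde_ge0.
(* The competitor is an exact minimizer, whose residual is [- v]. *)
have := opt (Y^T *m (U^T *m b)).
rewrite -!mulmxA -!mulmxBr ez.
have -> : A *m (Y^T *m (U^T *m b)) - b = - v.
  by rewrite mulmxA -[A]trmxK -trmx_mul -UY trmxK /v opprB.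
rewrite !sqnorm_sketch // => h.
set g := cross_term U c v w.
have zg := dot_cross_term U c v w z; rewrite -/g in zg.
have e : \sum_(j | w j) (U *m z - v) j 0 ^+ 2 / ptilde U c j =
   \sum_(j | w j) (U *m z) j 0 ^+ 2 / ptilde U c j - 2 * (z^T *m g) 0 0
   + \sum_(j | w j) (- v) j 0 ^+ 2 / ptilde U c j.
  rewrite zg mulr_sumr -sumrB -big_split /=; apply: eq_bigr => j _.
  by rewrite [(_ - v) j 0]mxE [(- v) j 0]mxE; ring.
have := low z; have := Cauchy_Schwarz z g.
rewrite sqnorm_orth_sub ?residual_orth // addrC lerD2l.
move: h; rewrite e; have := sqnorm_ge0 z; have := sqnorm_ge0 g.
set s := sqnorm z; set t := sqnorm g; set u := (z^T *m g) 0 0.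
set y := \sum_(j | w j) (U *m z) j 0 ^+ 2 / _; set y' := \sum_(j | w j) _.
move=> t0 s0 h1 h2 h3.
have su : s <= 4 * u by lra.
have : s ^+ 2 <= 16 * (s * t).
  have : s ^+ 2 <= (4 * u) ^+ 2 by rewrite ler_sqr ?nnegrE //; lra.
  rewrite exprMn; lra.
case: (ltrP 0 s) => [sp|s_le0] h4; last by lra.
by rewrite -(ler_pM2l sp); move: h4; rewrite expr2; lra.
Qed.

End SketchedSolution.
End Regression.

(** * Choice of the exponent *)

Section Numerics.
Variable R : realType.

(** Supplies an exponent for the trace inequalities, a power of two, at the cost of a factor 2; the
    successor makes it even. *)
Lemma dyadic_between (x : R) : 1 <= x ->
  exists m : nat, x <= (2 ^ m.+1)%:R /\ (2 ^ m.+1)%:R <= 2 * x.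
Proof.
move=> x1; have x0 : 0 <= 2 * x by lra.
have /andP [lo hi] := Num.Theory.truncn_itv x0.
set N := Num.truncn (2 * x) in lo hi.
have N2 : (2 <= N)%N by rewrite -ltnS -(ltr_nat R); lra.
exists (trunc_log 2 N).-1; rewrite prednK ?trunc_log_gt0 //.
have := @trunc_log_bounds 2 N isT (ltnW N2).
set t := trunc_log 2 N => /andP [h1 h2].
have {}h1 : (2 ^ t)%:R <= N%:R :> R by rewrite ler_nat.
have {}h2 : N.+1%:R <= (2 ^ t.+1)%:R :> R by rewrite ler_nat.
by rewrite expnS natrM in h2; split; lra.
Qed.

(** From [6 / 7 <= exp (- 1 / 7)]: the threshold makes the power at most [exp (- 200) / d], and
    [exp 200 >= 201]. *)
Lemma pow_six_sevenths (r d q : nat) : (0 < d)%N -> (r <= d)%N ->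
  7 * (200 + ln (d%:R : R)) <= q%:R -> r%:R * (6 / 7 : R) ^+ q <= 1 / 200.
Proof.
move=> d0 rd hq.
have dp : 0 < d%:R :> R by rewrite ltr0n.
have e67 : (6 / 7 : R) <= sequences.expR (- (1 / 7)).
  by apply: le_trans (expR_ge1Dx _); lra.
have pw : (6 / 7 : R) ^+ q <= (200 * d%:R)^-1.
  apply: (@le_trans _ _ (sequences.expR (- (1 / 7)) ^+ q)).
    by rewrite lerXn2r ?nnegrE ?expR_ge0 //; lra.
  rewrite -expRM_natl mulrN expRN lef_pV2 ?posrE ?expR_gt0 ?mulr_gt0 //.
  apply: (@le_trans _ _ (sequences.expR (200 + ln (d%:R : R)))); last first.
    by rewrite ler_expR; lra.
  rewrite expRD lnK ?posrE // ler_pM2r //.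
  by apply: le_trans (expR_ge1Dx _); lra.
apply: le_trans (ler_wpM2l _ pw) _ => //.
rewrite invfM mulrA ler_pdivrMr // mulrC.
have : r%:R <= d%:R :> R by rewrite ler_nat.
lra.
Qed.

End Numerics.

(** * Choice of constants and union of the two failure events *)

Theorem theorem1p1 (R : realType) (D : R) :
  1 <= D ->
  exists C : R, 0 < C /\
  forall (n d r : nat) (A : 'M[R]_(n, d)) (b : 'cV[R]_n) (U : 'M[R]_(n, r)),
  orthonormal_basis_of_colspan A U ->
  forall eps : R, 0 < eps < 1 ->
  forall (k : nat) (mu : outcome n -> R) (c : R),
  is_distr mu ->
  homogeneous mu k ->
  one_sided_linf_indep mu D ->
  0 < c ->
  (forall i : 'I_n, Pr mu (fun w => w i) = ptilde U c i) ->
  forall xt : outcome n -> 'cV[R]_d,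
  (forall (w : outcome n) (x : 'cV[R]_d),
      sqnorm (sketch (ptilde U c) w *m A *m xt w - sketch (ptilde U c) w *m b)
      <= sqnorm (sketch (ptilde U c) w *m A *m x - sketch (ptilde U c) w *m b)) ->
  C * (d%:R * ln (d%:R : R) + d%:R / eps) <= k%:R ->
  99 / 100 <= Pr mu (fun w => forall x : 'cV[R]_d,
                 sqnorm (A *m xt w - b) <= (1 + eps) * sqnorm (A *m x - b)).
Proof.
move=> D1.
have D2 : D <= D ^+ 2 by rewrite expr2 ler_peMl //; lra.
(* [22400 = 8 * 14 * 200]: the exponent is at most [14 (200 + ln d)], and [c] must exceed [8 D^2]
   times it. The Markov step below asks for less. *)
exists (22400 * D ^+ 2); split; first by nra.
move=> n d r A b U AU eps /andP [eps0 eps1] k mu c mu_distr mu_hom mu_indep c0 mu_marg xt opt hk.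
set good := (X in Pr mu X).
have mu0 w : 0 <= mu w by apply: mu_distr.1.
have Pr_good : Pr mu good = 1 - \sum_(w | ~~ `[< good w >]) mu w.
  by rewrite -mu_distr.2 [X in _ = X - _](bigID (fun w => `[< good w >])) /= addrK.
rewrite Pr_good.
suff : \sum_(w | ~~ `[< good w >]) mu w <= 1 / 100 by lra.
(* For [d = 0] there is a single vector [x], so no outcome fails. *)
have [d0|dpos] := posnP d.
  rewrite big1; first by lra.
  move=> w /asboolP; case => x; subst d.
  have -> : x = xt w by apply/matrixP => -[].
  by rewrite ler_peMl ?sqnorm_ge0 //; lra.
have UU := AU.1.
have dp : 0 < d%:R :> R by rewrite ltr0n.
have rd := orthonormal_basis_le AU.
have ln0 : 0 <= ln (d%:R : R) by apply: ln_ge0; rewrite ler1n.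
(* By homogeneity [k] is the sum of the marginals, at most [c] times the rank; thus the lower bound
   on [k] becomes one on [c]. *)
have kc : k%:R <= c * d%:R.
  have <- : \sum_i ptilde U c i = k%:R.
    have := sum_cprob mu_distr mu_hom (S := set0).
    rewrite cards0 subr0 upmass0 // ltr01 => /(_ isT) <-.
    by apply: eq_big => i; rewrite ?in_set0 // (cprob_set0 mu_distr mu_marg).
  apply: (@le_trans _ _ (\sum_i c * leverage U i)).
    by apply: ler_sum => i _; rewrite ge_min lexx orbT.
  by rewrite -mulr_sumr sum_leverage // ler_pM2l // ler_nat.
have c_ge : 22400 * D ^+ 2 * (ln (d%:R : R) + eps^-1) <= c.
  rewrite -(ler_pM2r dp); apply: le_trans kc; apply: le_trans hk.
  by rewrite le_eqVlt; apply/orP; left; apply/eqP; ring.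
have eps_inv : 1 <= eps^-1 by rewrite -[1]invr1 lef_pV2 ?posrE // ltW.
have D20 : 0 <= D ^+ 2 by apply: sqr_ge0.
have x1 : 1 <= 7 * (200 + ln (d%:R : R)) by lra.
have [m [q_lo q_hi]] := dyadic_between x1.
have c_large : 8 * (2 ^ m.+1)%:R * D ^+ 2 <= c.
  apply: le_trans c_ge.
  rewrite [leRHS]mulrAC; apply: ler_wpM2r => //; lra.
have tail := spectral_lower_tail D1 UU mu_distr mu_hom mu_indep c0 mu_marg c_large.
have {}tail := le_trans tail (pow_six_sevenths dpos rd q_lo).
set v := b - U *m (U^T *m b).
have v_orth : U^T *m v = 0 by apply: residual_orth AU.
have moment := cross_term_second_moment D1 mu_distr mu_indep c0 mu_marg v_orth.
pose low w := `[< spectral_lower U c w >].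
(* Under the spectral bound, failure forces a large cross term; its strictness also excludes
   [v = 0], for which Markov's inequality would be void. *)
have bad_cross w : ~~ `[< good w >] -> low w ->
    0 < sqnorm v /\ eps * sqnorm v <= 16 * sqnorm (cross_term U c v w).
  move=> /asboolP /existsNP [x /negP]; rewrite -ltNge => hx /asboolP hl.
  have h1 := sketched_excess AU c0 hl (opt w).
  have h2 := residual_min b AU x.
  have h3 : (1 + eps) * sqnorm v <= (1 + eps) * sqnorm (A *m x - b).
    by rewrite ler_wpM2l //; lra.
  have h4 : (1 + eps) * sqnorm v < sqnorm v + 16 * sqnorm (cross_term U c v w).
    exact: le_lt_trans h3 (lt_le_trans hx h1).
  split; last by lra.
  rewrite lt_def sqnorm_ge0 andbT; apply/eqP => v0.
  move: h4; rewrite v0 (_ : cross_term U c v w = 0).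
    by rewrite sqnormE mulmx0 mxE !mulr0 addr0 ltxx.
  apply/matrixP => a i; rewrite !mxE big1 // => j _.
  by rewrite (sqnorm_eq0 v0) mxE !mul0r.
(* Failures with and without the spectral bound are allotted [1 / 200] each. *)
rewrite (bigID low) /=.
have -> : 1 / 100 = 1 / 200 + 1 / 200 :> R by field.
rewrite addrC; apply: lerD.
  apply: le_trans tail; rewrite [leRHS](bigID (fun w => `[< good w >])) /=.
  rewrite addrC; apply: ler_wpDr; first exact: sumr_ge0.
  by rewrite le_eqVlt; apply/orP; left; apply/eqP/eq_bigl => w; rewrite asbool_neg andbC.
have [/eqP v0|v0] := boolP (sqnorm v == 0).
  rewrite big1; first by lra.
  move=> w /andP [h1 h2]; have [vp _] := bad_cross w h1 h2.
  by rewrite v0 ltxx in vp.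
have vp : 0 < sqnorm v by rewrite lt_def v0 sqnorm_ge0.
have ev : 0 < eps * sqnorm v by rewrite mulr_gt0.
rewrite -(ler_pM2r ev) mulr_suml.
apply: (@le_trans _ _ (16 * \sum_w mu w * sqnorm (cross_term U c v w))).
  rewrite mulr_sumr [leRHS](bigID (fun w => ~~ `[< good w >] && low w)) /=.
  apply: ler_wpDr; first by apply: sumr_ge0 => w _; rewrite !mulr_ge0 ?sqnorm_ge0.
  apply: ler_sum => w /andP [h1 h2]; have [_ h] := bad_cross w h1 h2.
  by rewrite [leRHS]mulrCA; apply: ler_wpM2l.
have k16 : 0 <= 16 :> R by [].
apply: le_trans (ler_wpM2l k16 moment) _.
rewrite !mulrA; apply: ler_wpM2r; first exact: ltW.
rewrite ler_pdivrMr //.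
(* [3200 = 16 * 200], from the excess bound and the allotted probability. *)
have : 3200 * D <= c * eps; last by lra.
rewrite -ler_pdivrMr //; apply: le_trans c_ge.
have e0 : 0 < eps^-1 by rewrite invr_gt0.
have : D * eps^-1 <= D ^+ 2 * eps^-1 by rewrite ler_pM2r.
have : 0 <= D ^+ 2 * ln (d%:R : R) by rewrite mulr_ge0.
have : 0 <= D ^+ 2 * eps^-1 by rewrite mulr_ge0 // ltW.
lra.
Qed.
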